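(* Let $G$ be a finite undirected graph (multiple edges and loops allowed) with $n=|V(G)|$ vertices, $\kappa$ connected components, and cyclomatic number $g=|E(G)|-n+\kappa$. Fix a reference orientation $O_{\mathrm{ref}}$ of $G$, a total order $<$ on $E(G)$, and arbitrary sign labels $\sigma_u,\sigma_b\colon E(G)\to\{+,-\}$. Then there exist fourientation cut activities $I\colon\mathcal{O}^4(G)\to\mathcal{S}(G)$ and fourientation cycle activities $L\colon\mathcal{O}^4(G)\to\mathcal{S}(G)$ (in the sense given in the context), as well as a map $\varphi\colon\mathcal{O}^4(G)\to\mathcal{S}(G)$, such that, as an identity in the indeterminates $k_1,k_2,l,m,x,w,\hat x,\hat w,y,z,\hat y,\hat z$, $$(k_1+m)^{n-\kappa}(k_2+l)^{g}\,T_G\!\left(\frac{k_1x+k_2w+m\hat{x}+l\hat{w}}{k_1+m},\frac{k_2y+k_1z+l\hat{y}+m\hat{z}}{k_2+l}\right)$$ $$=\sum_{O\in\mathcal{O}^4(G)} k_1^{|O^o\cap\varphi(O)|}\,k_2^{|O^o\setminus\varphi(O)|}\,l^{|O^u|}\,m^{|O^b|}\,x^{|I^+(O)|}\,w^{|I^-(O)|}\,\hat{x}^{|I^b(O)|}\,\hat{w}^{|I^u(O)|}\,y^{|L^+(O)|}\,z^{|L^-(O)|}\,\hat{y}^{|L^u(O)|}\,\hat{z}^{|L^b(O)|},$$ where for $*\in\{+,-,u,b\}$ we write $I^*(O):=I(O)\cap O^*$ and $L^*(O):=L(O)\cap O^*$.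
   Context: $\mathcal{S}(G):=2^{E(G)}$ is the set of spanning subgraphs of $G$, identified with subsets of $E(G)$. For $S\in\mathcal{S}(G)$, $\kappa(S)$ is the number of connected components of $(V(G),S)$. The Tutte polynomial is $T_G(x,y):=\sum_{S\in\mathcal{S}(G)}(x-1)^{\kappa(S)-\kappa}(y-1)^{|S|+\kappa(S)-n}$. A reference orientation $O_{\mathrm{ref}}$ chooses for each edge $e=\{a,b\}$ a positive direction $e^+=(a,b)$ and hence a negative direction $e^-=(b,a)$; $e^+$ and $e^-$ are distinct formal symbols even when $e$ is a loop. Put $\mathbb{E}(G):=\{e^+,e^-\colon e\in E(G)\}$. A fourientation of $G$ is an arbitrary subset $O\subseteq\mathbb{E}(G)$; $\mathcal{O}^4(G)$ is the set of all fourientations. In $O$ an edge $e$ is unoriented if $\{e^+,e^-\}\cap O=\varnothing$, bioriented if $\{e^+,e^-\}\subseteq O$, and oriented otherwise. $O^u,O^b,O^o\subseteq E(G)$ denote the sets of unoriented, bioriented and oriented edges; $O^+$ (resp. $O^-$) is the set of oriented edges $e\in O^o$ with $e^+\in O$ (resp. $e^-\in O$), so $O^o=O^+\sqcup O^-$. A cut of $G$ is a minimal nonempty set of edges whose removal increases the number of connected components; it is the set of edges joining some $X\subset V(G)$ to its complement, and has two consistent orientations (out of $X$, into $X$). A cycle is (the edge set of) a simple cycle of $G$ (a loop is a cycle of length one), and has two consistent orientations. A directed cut (cycle) $C$ is a cut (cycle) with one of its two consistent orientations chosen; $\mathbb{E}(C)\subseteq\mathbb{E}(G)$ is its set of directed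 edges. A directed cut $Cu$ is a potential cut of a fourientation $O$ if $e^\delta\in\mathbb{E}(Cu)$ implies $e^{-\delta}\notin O$ (for $\delta\in\{+,-\}$). A directed cycle $Cy$ is a potential cycle of $O$ if $e^\delta\in\mathbb{E}(Cy)$ implies $e^\delta\in O$. ''Min edge'' means minimum with respect to $<$. Maps $I,L\colon\mathcal{O}^4(G)\to\mathcal{S}(G)$ are fourientation cut activities and fourientation cycle activities, respectively, if for every $O\in\mathcal{O}^4(G)$: (1) $I(O)\cap O^o=\{e\in O^o\colon e$ is the min edge in some potential cut of $O\}$; (2) $L(O)\cap O^o=\{e\in O^o\colon e$ is the min edge in some potential cycle of $O\}$; (3) $I(O)\cap O^u=\{e\in O^u\colon e$ is the min edge in some potential cut of $O\cup\{e^{\sigma_u(e)}\}\}$; (4) $L(O)\cap O^b=\{e\in O^b\colon e$ is the min edge in some potential cycle of $O\setminus\{e^{\sigma_b(e)}\}\}$. *)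

(* Defs.v *)
From HB Require Import structures.
From mathcomp Require Import all_boot all_order all_algebra.
From mathcomp Require Import mpoly.

Set Implicit Arguments.
Unset Strict Implicit.
Unset Printing Implicit Defensive.

Import GRing.Theory.
Local Open Scope ring_scope.

(* Finite undirected graph; parallel edges are distinct [e], [f] with
   [ends e = ends f], and [e] is a loop when [#|ends e| = 1]. *)
Record multigraph := Multigraph {
  vertex : finType;
  edge : finType;
  ends : edge -> {set vertex};
  ends_card : forall e, (0 < #|ends e| <= 2)%N
}.

Definition adj (G : multigraph) (S : {set edge G}) : rel (vertex G) :=
  [rel a b | [exists e in S, ends e == [set a; b]]].

Definition kappa (G : multigraph) (S : {set edge G}) : nat :=
  n_comp (adj S) predT.

(* Both natural-number subtractions in the exponents are exact: deleting edges
   can only increase [kappa], and #|S| edges merge at most #|S| components. *)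
Definition tutte (G : multigraph) : {mpoly int[2]} :=
  \sum_(S : {set edge G})
     ('X_(inord 0) - 1) ^+ (kappa S - kappa [set: edge G])
   * ('X_(inord 1) - 1) ^+ (#|S| + kappa S - #|vertex G|).

Definition tutte_eval (R : comNzRingType) (G : multigraph) (a b : R) : R :=
  mmap intr (tnth [tuple a; b]) (tutte G).

Lemma tutte_evalE (R : comNzRingType) (G : multigraph) (a b : R) :
  tutte_eval G a b =
  \sum_(S : {set edge G})
     (a - 1) ^+ (kappa S - kappa [set: edge G])
   * (b - 1) ^+ (#|S| + kappa S - #|vertex G|).
Proof.
rewrite /tutte_eval /tutte raddf_sum /=; apply: eq_bigr => S _.
rewrite rmorphM !rmorphXn !rmorphB !rmorph1 /= !mmapX !mmap1U.
by rewrite !(tnth_nth 0) /= !inordK.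
Qed.

Record ref_orientation (G : multigraph) := RefOrientation {
  rtail : edge G -> vertex G;
  rhead : edge G -> vertex G;
  rendsE : forall e, ends e = [set rtail e; rhead e]
}.

(* [(e, true)] is e^+ and [(e, false)] is e^-; signs are Booleans throughout.
   The two are distinct even when [e] is a loop. *)
Notation diredge G := (edge G * bool)%type.
Notation fourientation G := {set (edge G * bool)%type}.

Section Directed.

Variables (G : multigraph) (Oref : ref_orientation G).
Implicit Types (O D : fourientation G) (d : diredge G) (X : {set vertex G}).

Definition dtail d := if d.2 then rtail Oref d.1 else rhead Oref d.1.
Definition dhead d := if d.2 then rhead Oref d.1 else rtail Oref d.1.
Definition opp d : diredge G := (d.1, ~~ d.2).

Definition unoriented O : {set edge G} :=
  [set e | ((e, true) \notin O) && ((e, false) \notin O)].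
Definition bioriented O : {set edge G} :=
  [set e | ((e, true) \in O) && ((e, false) \in O)].
Definition oriented O : {set edge G} := ~: (unoriented O :|: bioriented O).
Definition oriented_pos O : {set edge G} :=
  [set e in oriented O | (e, true) \in O].
Definition oriented_neg O : {set edge G} :=
  [set e in oriented O | (e, false) \in O].

Definition disconnecting (C : {set edge G}) : bool :=
  (C != set0) && (kappa [set: edge G] < kappa (~: C))%N.
Definition is_cut (C : {set edge G}) : bool := minset disconnecting C.

Definition edges_across X : {set edge G} :=
  [set e | ~~ [disjoint ends e & X] && ~~ (ends e \subset X)].

(* Directed cuts and directed cycles are represented by their sets of directed
   edges.  Taking the complement of [X] gives the opposite orientation. *)
Definition directed_cut D : Prop :=
  exists X, is_cut (edges_across X)
         /\ D = [set d | (dtail d \in X) && (dhead d \notin X)].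

(* A nonempty closed walk with distinct vertices and distinct edges; the last
   condition excludes e^+ followed by e^-. *)
Definition directed_cycle D : Prop :=
  exists p : seq (diredge G),
    [/\ p != [::], cycle [rel d d' | dhead d == dtail d'] p,
        uniq (map dtail p), uniq (map fst p) & D = [set d in p]].

Definition potential_cut O D : Prop :=
  directed_cut D /\ forall d, d \in D -> opp d \notin O.
Definition potential_cycle O D : Prop :=
  directed_cycle D /\ forall d, d \in D -> d \in O.

Variable le : rel (edge G).

Definition total_order : Prop :=
  [/\ reflexive le, antisymmetric le, transitive le & total le].

Definition min_edge D (e : edge G) : Prop :=
  e \in [set d.1 | d in D] /\ forall f, f \in [set d.1 | d in D] -> le e f.

Definition min_in_potential_cut O (e : edge G) : Prop :=
  exists D, potential_cut O D /\ min_edge D e.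
Definition min_in_potential_cycle O (e : edge G) : Prop :=
  exists D, potential_cycle O D /\ min_edge D e.

Definition cut_activities (su : edge G -> bool)
    (I : fourientation G -> {set edge G}) : Prop :=
  forall O,
    (forall e, e \in I O :&: oriented O <->
       e \in oriented O /\ min_in_potential_cut O e)
 /\ (forall e, e \in I O :&: unoriented O <->
       e \in unoriented O /\ min_in_potential_cut ((e, su e) |: O) e).

Definition cycle_activities (sb : edge G -> bool)
    (L : fourientation G -> {set edge G}) : Prop :=
  forall O,
    (forall e, e \in L O :&: oriented O <->
       e \in oriented O /\ min_in_potential_cycle O e)
 /\ (forall e, e \in L O :&: bioriented O <->
       e \in bioriented O /\ min_in_potential_cycle (O :\ (e, sb e)) e).

End Directed.

Definition indet (i : 'I_12) : {fraction {mpoly int[12]}} := tofrac 'X_i.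

(* Main.v *)
(** All activities are statements about reachability along directed edges.  By
    colouring arguments of Minty type, an edge directed by [d] is the minimum of
    a potential cut iff the tail of [d] cannot be reached from its head when all
    smaller edges may be used both ways and larger ones as prescribed by [O]; it
    is the minimum of a potential cycle iff the tail can be reached from the
    head using only larger edges as prescribed by [O].

    Run through the edges from the largest to the smallest, replacing each edge
    by a bioriented one ("contract") or by an unoriented one ("delete"), so that
    the activities of all smaller edges do not change.  An active edge, i.e. a
    bridge or a loop once the larger edges are contracted or deleted, is
    deleted.  For any other edge [e], unoriented means delete and bioriented
    means contract; of the two orientations, one can be contracted and the other
    deleted.  Indeed the only obstructions are arc sets, one or two per smaller
    edge, along which the ends of [e] are connected in exactly one direction;
    these arc sets form a chain, so that direction is the same for all of them.

    Consequently the sum over the four states of [e] obeys the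
    deletion-contraction recursion of the homogenized Tutte polynomial. *)

From mathcomp Require Import all_boot all_order all_algebra.
From mathcomp Require Import zify ring.
Require Import Defs.

Set Implicit Arguments.
Unset Strict Implicit.
Unset Printing Implicit Defensive.

(** * Reachability along directed edges *)

Section Reachability.

Variables (G : multigraph) (Oref : ref_orientation G).
Implicit Types (M N : fourientation G) (d : diredge G) (A : {set edge G}).

Local Notation tl := (dtail Oref).
Local Notation hd := (dhead Oref).

Definition arc M : rel (vertex G) :=
  [rel u v | [exists d in M, (tl d == u) && (hd d == v)]].

Definition reach M : rel (vertex G) := connect (arc M).

Definition both_dirs A : fourientation G := [set d | d.1 \in A].

Lemma in_both_dirs A d : (d \in both_dirs A) = (d.1 \in A).
Proof. by rewrite inE. Qed.

Lemma arcP M u v :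
  reflect (exists2 d, d \in M & tl d = u /\ hd d = v) (arc M u v).
Proof.
apply: (iffP existsP) => [[d /and3P[dM /eqP tu /eqP hv]]|[d dM [tu hv]]].
  by exists d.
by exists d; rewrite dM tu hv !eqxx.
Qed.

Lemma oppK : involutive (@opp G).
Proof. by case=> e s; rewrite /opp /= negbK. Qed.

Lemma dtail_opp d : tl (opp d) = hd d.
Proof. by case: d => e []. Qed.

Lemma dhead_opp d : hd (opp d) = tl d.
Proof. by case: d => e []. Qed.

Lemma ends_dir d : ends d.1 = [set tl d; hd d].
Proof. by case: d => e []; rewrite (rendsE Oref) // setUC. Qed.

Lemma diredge_eqVopp d d' : d.1 = d'.1 -> d' = d \/ d' = opp d.
Proof.
by case: d d' => [e s] [e' s'] /= ->; rewrite /opp /=;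
  case: s s' => [] []; [left|right|right|left].
Qed.

(** Induction along walks, used mostly to certify unreachability by a closed vertex set. *)
Lemma reach_closed M (Y : pred (vertex G)) u v :
    (forall d, d \in M -> Y (tl d) -> Y (hd d)) ->
  reach M u v -> Y u -> Y v.
Proof.
move=> clY /connectP[p Mp ->]; elim: p u Mp => //= w p IHp u.
case/andP=> /arcP[d dM [<- <-]] /IHp IH Yu; exact/IH/clY.
Qed.

Lemma reach_refl M u : reach M u u.
Proof. exact: connect0. Qed.

Lemma reach_trans M u v w : reach M u v -> reach M v w -> reach M u w.
Proof. exact: connect_trans. Qed.

Lemma reach_arc M d : d \in M -> reach M (tl d) (hd d).
Proof. by move=> dM; apply/connect1/arcP; exists d. Qed.

Lemma reach_sub M N u v : M \subset N -> reach M u v -> reach N u v.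
Proof.
move=> /subsetP sMN; apply: connect_sub => a b /arcP[d /sMN dN [<- <-]].
exact: reach_arc.
Qed.

(** Cut a walk before its first and after its last use of [d]: one passage suffices. *)
Lemma reachU1 M d u v :
  reach (d |: M) u v = reach M u v || reach M u (tl d) && reach M (hd d) v.
Proof.
have sM : M \subset d |: M by apply: subsetUr.
apply/idP/orP => [uv|[|/andP[ut hv]]]; last 2 first.
- exact: reach_sub.
- apply: reach_trans (reach_sub sM ut) _.
  by apply: reach_trans (reach_arc _) (reach_sub sM hv); rewrite setU11.
apply/orP.
pose Y y := reach M u y || reach M u (tl d) && reach M (hd d) y.
apply: (reach_closed (Y := Y) _ uv); last by rewrite /Y reach_refl.
move=> d'; rewrite in_setU1 /Y => /predU1P[-> | d'M].
  by case/orP=> [->|/andP[-> _]]; rewrite reach_refl orbT.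
case/orP=> [ut'|/andP[-> ht']].
  by rewrite (reach_trans ut' (reach_arc d'M)).
by rewrite (reach_trans ht' (reach_arc d'M)) orbT.
Qed.

Lemma reach_sym M :
  (forall d, d \in M -> opp d \in M) -> symmetric (reach M).
Proof.
move=> symM; apply: sym_connect_sym => u v.
have half a b : arc M a b -> arc M b a.
  case/arcP=> d /symM dM [<- <-]; apply/arcP; exists (opp d) => //.
  by rewrite dtail_opp dhead_opp.
by apply/idP/idP; apply: half.
Qed.

Lemma both_dirs_opp A d : d \in both_dirs A -> opp d \in both_dirs A.
Proof. by rewrite !inE. Qed.

Lemma set2_eq (T : finType) (a b c d : T) :
  [set a; b] = [set c; d] -> a = c /\ b = d \/ a = d /\ b = c.
Proof.
move/setP=> E; move: (E a) (E b) (E c) (E d); rewrite !inE !eqxx !orbT /=.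
move=> /esym/orP Ea /esym/orP Eb /orP Ec /orP Ed.
case: Ea => /eqP Ea; case: Eb => /eqP Eb; case: Ec => /eqP Ec;
  case: Ed => /eqP Ed; subst; auto.
Qed.

Lemma arc_both_dirs A : arc (both_dirs A) =2 adj A.
Proof.
move=> u v; apply/arcP/existsP => [[d]|[e /andP[eA /eqP]]].
  rewrite inE => dA [<- <-]; exists d.1.
  by rewrite dA ends_dir eqxx.
rewrite (ends_dir (e, true)) => /set2_eq [] [tu hv].
  by exists (e, true); rewrite ?inE.
by exists (e, false); rewrite ?inE.
Qed.

Lemma reach_both_dirs A : reach (both_dirs A) =2 connect (adj A).
Proof. exact/eq_connect/arc_both_dirs. Qed.

Lemma adj_sym A : symmetric (adj A).
Proof. by move=> u v; rewrite /adj /= setUC. Qed.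

End Reachability.

(** * Connected components and bonds *)

Section Components.

Variables (G : multigraph) (Oref : ref_orientation G).
Implicit Types (A S : {set edge G}) (e : edge G).

Definition joined A e := connect (adj A) (rtail Oref e) (rhead Oref e).

Lemma adj_connect_sym A : connect_sym (adj A).
Proof. exact/sym_connect_sym/adj_sym. Qed.

Lemma both_dirsU1 A e :
  both_dirs (e |: A) = (e, true) |: ((e, false) |: both_dirs A).
Proof.
by apply/setP=> -[f []]; rewrite !inE /= !xpair_eqE ?andbT ?andbF.
Qed.

Lemma connect_adjU1 A e x y (a := rtail Oref e) (b := rhead Oref e)
    (B := [pred z | connect (adj A) z a || connect (adj A) z b]) :
  connect (adj (e |: A)) x y = connect (adj A) x y || B x && B y.
Proof.
rewrite -!(reach_both_dirs Oref) both_dirsU1 !reachU1 /dtail /dhead /=.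
rewrite !(reach_both_dirs Oref) -/a -/b /B /= !connect0.
rewrite ![connect (adj A) y _]adj_connect_sym.
by do ![case: (connect _ _ _)].
Qed.

(** Adding [e] affects only [B], the union of the components of its two ends, which becomes a single
    component. *)
Lemma kappaU1 A e : (kappa (e |: A) + ~~ joined A e)%N = kappa A.
Proof.
set a := rtail Oref e; set b := rhead Oref e.
pose B := [pred z | connect (adj A) z a || connect (adj A) z b].
have connE x y : connect (adj (e |: A)) x y = connect (adj A) x y || B x && B y.
  exact: connect_adjU1.
have clB S : (forall z, B z = connect (adj S) z a || connect (adj S) z b) ->
    n_comp (adj S) B = (~~ connect (adj S) a b).+1.
  move=> BE; rewrite -(n_comp_closure2 (adj_connect_sym S)).
  apply: eq_n_comp_r => z; rewrite [LHS]BE.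
  apply/orP/existsP => [[za|zb]|[t /andP[/= zt /pred2P[<-|<-]]]]; auto.
    by exists a; rewrite !inE eqxx za.
  by exists b; rewrite !inE eqxx zb orbT.
have Ba : B a by rewrite /B /= connect0.
have Bb : B b by rewrite /B /= connect0 orbT.
rewrite /kappa !(n_compC B) (clB A) // (clB (e |: A)); last first.
  by move=> z; rewrite !connE Ba Bb !andbT /B /=; do ![case: (connect _ _ _)].
rewrite connE Ba Bb orbT.
suff -> : n_comp (adj (e |: A)) [predC B] = n_comp (adj A) [predC B].
  by rewrite /joined -/a -/b addnAC.
(* Outside [B] connectivity is unchanged, and the canonical root of [x] depends only on the vertices
   connected to [x]. *)
apply: eq_card => x; rewrite !inE -[connect _ x a || _]/(B x).
case Bx: (B x); rewrite ?andbF // !andbT /roots /fingraph.root.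
rewrite (eq_pick (Q := connect (adj A) x)) // => y.
by rewrite connE Bx orbF.
Qed.

End Components.

Section Cuts.

Variables (G : multigraph) (Oref : ref_orientation G).
Implicit Types (A B S : {set edge G}) (e f : edge G) (d : diredge G).
Implicit Types (W Z : {set vertex G}).

Local Notation tl := (dtail Oref).
Local Notation hd := (dhead Oref).

Lemma kappaS A B : A \subset B -> (kappa B <= kappa A)%N.
Proof.
move: {2}#|B :\: A| (leqnn #|B :\: A|) => n.
elim: n A => [|n IHn] A leBA sAB.
  have sBA : B \subset A by rewrite -setD_eq0 -cards_eq0 -leqn0.
  by rewrite (_ : B = A) //; apply/eqP; rewrite eqEsubset sAB sBA.
have [D0|[e eBA]] := set_0Vmem (B :\: A).
  by apply: IHn => //; rewrite D0 cards0.
have sA'B : e |: A \subset B.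
  by rewrite subUset sub1set sAB andbT; case/setDP: eBA.
have leA'B : (#|B :\: (e |: A)| <= n)%N.
  by move: leBA; rewrite (cardsD1 e) eBA setDDl [A :|: _]setUC.
by apply: leq_trans (IHn _ leA'B sA'B) _; rewrite -(kappaU1 Oref A e) leq_addr.
Qed.

Lemma kappa_ltT A e : ~~ joined Oref A e -> (kappa [set: edge G] < kappa A)%N.
Proof.
move=> nj; rewrite -(kappaU1 Oref A e) nj addn1 ltnS.
exact/kappaS/subsetT.
Qed.

Lemma kappa_eqT A : (forall e, joined Oref A e) -> kappa A = kappa [set: edge G].
Proof.
move=> jA; have clA u v : adj [set: edge G] u v -> connect (adj A) u v.
  case/existsP=> e /andP[_ /eqP]; rewrite (rendsE Oref).
  case/set2_eq => -[<- <-]; first exact: jA.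
  rewrite adj_connect_sym; exact: jA.
apply: eq_n_comp => u v; apply/idP/idP; last exact: connect_sub.
apply: connect_sub => a b /existsP[e /andP[_ ab]].
by apply: connect1; apply/existsP; exists e; rewrite inE.
Qed.

Lemma joinedE A d : joined Oref A d.1 = reach Oref (both_dirs A) (tl d) (hd d).
Proof.
by rewrite reach_both_dirs; case: d => e []; rewrite // adj_connect_sym.
Qed.

Lemma mem_edges_across d Z :
  (d.1 \in edges_across Z) = ((tl d \in Z) != (hd d \in Z)).
Proof.
rewrite inE (ends_dir Oref) subUset !sub1set disjoints_subset subUset !sub1set.
by rewrite !inE; case: (tl d \in Z); case: (hd d \in Z).
Qed.

(** For [u] in [W], the component of [u] in the subgraph induced by [W]. *)
Definition component W (u : vertex G) : {set vertex G} :=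
  [set v | reach Oref (both_dirs [set f | ends f \subset W]) u v].

Lemma component_refl W u : u \in component W u.
Proof. by rewrite inE reach_refl. Qed.

Lemma component_sub W u : u \in W -> component W u \subset W.
Proof.
move=> uW; apply/subsetP => v; rewrite inE => uv.
apply: (reach_closed (Y := [in W]) _ uv uW) => d.
by rewrite !inE (ends_dir Oref) subUset !sub1set => /andP[].
Qed.

Lemma component_out W u d : u \in W ->
  tl d \in component W u -> hd d \notin component W u -> hd d \notin W.
Proof.
move=> uW tC; apply: contra => hW; have tW := subsetP (component_sub uW) _ tC.
move: tC; rewrite !inE => /reach_trans; apply; apply: reach_arc.
by rewrite !inE (ends_dir Oref) subUset !sub1set tW.
Qed.

Lemma component_reach W A u v :
    (forall d, tl d \in component W u -> hd d \in component W u -> d.1 \in A) ->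
  v \in component W u -> reach Oref (both_dirs A) u v.
Proof.
move=> inA; rewrite inE => uv.
pose Y := [pred y | (y \in component W u) && reach Oref (both_dirs A) u y].
suff /andP[] : Y v by [].
apply: (reach_closed (Y := Y) _ uv) => [d dS /andP[tC ut]|]; last first.
  by rewrite /Y /= component_refl reach_refl.
have hC : hd d \in component W u.
  by move: tC; rewrite !inE => /reach_trans; apply; apply: reach_arc.
rewrite /Y /= hC /=; apply: reach_trans ut (reach_arc Oref _).
by rewrite inE inA.
Qed.

(* A directed edge leaving [X] lies in a bond all of whose edges leave [X]:
   take the component of its head outside [X], then the component of its tail
   outside the former. *)
Lemma cut_contains_bond (X : {set vertex G}) d : tl d \in X -> hd d \notin X ->
  exists Z, [/\ is_cut (edges_across Z), tl d \in Z, hd d \notin Z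
    & forall d', tl d' \in Z -> hd d' \notin Z ->
        tl d' \in X /\ hd d' \notin X].
Proof.
move=> tX hX; set Y := component (~: X) (hd d).
have hX' : hd d \in ~: X by rewrite inE.
have hY : hd d \in Y by apply: component_refl.
have sYX : Y \subset ~: X := component_sub hX'.
have tY : tl d \in ~: Y.
  by rewrite inE; apply: contraL tX => /(subsetP sYX); rewrite inE.
set Z := component (~: Y) (tl d).
have tZ : tl d \in Z by apply: component_refl.
have sZY : Z \subset ~: Y := component_sub tY.
have hZ : hd d \notin Z by apply: contraL hY => /(subsetP sZY); rewrite inE.
(* An edge leaving [Z] enters [Y], or its head would still be in the component [Z]. Its tail is then
   in [X], or it would belong to the component [Y]. *)
have outZ d' : tl d' \in Z -> hd d' \notin Z -> hd d' \in Y /\ tl d' \in X.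
  move=> tZ' hZ'; have hY' : hd d' \in Y.
    by have := component_out tY tZ' hZ'; rewrite inE negbK.
  split=> //; have := subsetP sZY _ tZ'; rewrite inE -dhead_opp => nY.
  rewrite -dtail_opp in hY'; have := component_out hX' hY' nY.
  by rewrite dhead_opp inE negbK.
exists Z; split=> //; last first.
  by move=> d' t' h'; have [/(subsetP sYX) + ->] := outZ _ t' h'; rewrite inE.
apply/minsetP; split=> [|B /andP[_ disB] sBC].
  apply/andP; split; first by apply/set0Pn; exists d.1; rewrite mem_edges_across tZ.
  apply: (@kappa_ltT _ d.1); rewrite joinedE.
  apply: contra hZ => th; apply: (reach_closed (Y := [in Z]) _ th tZ) => d'.
  by rewrite 2!inE mem_edges_across negbK => /eqP ->.
(* Minimality: [Z] and [Y] are each internally connected by edges that do not cross. If [B] misses a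
   crossing edge [f], this edge still ties [Z] to [Y], so deleting [B] separates the ends of no
   edge. *)
apply/eqP; rewrite eqEsubset sBC; apply/subsetP => f fC; apply: contraLR disB.
move=> fB; rewrite -leqNgt leq_eqVlt kappa_eqT ?eqxx // => e.
have linkZ v : v \in Z -> reach Oref (both_dirs (~: B)) (tl d) v.
  apply: component_reach => d' t' h'; rewrite inE; apply: contraTN t'.
  by move/(subsetP sBC); rewrite mem_edges_across h' eqb_id => ->.
have linkY v : v \in Y -> reach Oref (both_dirs (~: B)) (hd d) v.
  have notZ y : y \in Y -> y \in Z = false.
    by move=> yY; apply: contraTF yY => /(subsetP sZY); rewrite inE.
  apply: component_reach => d' /notZ t' /notZ h'; rewrite inE.
  by apply/negP => /(subsetP sBC); rewrite mem_edges_across t' h'.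
have symB := reach_sym Oref (@both_dirs_opp _ (~: B)).
have cross g : g \in edges_across Z ->
    exists2 c, c.1 = g & tl c \in Z /\ hd c \in Y.
  move=> gC; have := gC; rewrite -[g]/((g, true).1) mem_edges_across.
  case tz: (tl (g, true) \in Z).
    rewrite -[true == _]/(_ \in Z) => hz; exists (g, true) => //.
    by split=> //; case: (outZ (g, true)).
  rewrite -[false == _]/(~~ (_ \in Z)) negbK => hz; exists (g, false) => //.
  have hz' : hd (g, false) \notin Z by rewrite [hd _]/(tl (g, true)) tz.
  by split=> //; case: (outZ (g, false)).
have [c c1 [tc hc]] := cross f fC.
have dlink : reach Oref (both_dirs (~: B)) (tl d) (hd d).
  apply: reach_trans (linkZ _ tc) _; rewrite symB.
  apply: reach_trans (linkY _ hc) _; rewrite symB.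
  by apply: reach_arc; rewrite !inE c1.
have [eC|eC] := boolP (e \in edges_across Z); last first.
  rewrite -[e]/((e, true).1) joinedE; apply: reach_arc; rewrite !inE /=.
  by apply: contra eC => /(subsetP sBC).
have [c' <- [tc' hc']] := cross e eC; rewrite joinedE.
apply: reach_trans (linkY _ hc'); apply: reach_trans dlink.
by rewrite symB linkZ.
Qed.

End Cuts.

(** * Potential cuts and cycles as reachability conditions *)

Section SimplePaths.

Variables (G : multigraph) (Oref : ref_orientation G).
Implicit Types (M : fourientation G) (d : diredge G) (p : seq (diredge G)).

Local Notation tl := (dtail Oref).
Local Notation hd := (dhead Oref).

Fixpoint dipath u p v : bool :=
  if p is d :: p' then (tl d == u) && dipath (hd d) p' v else u == v.

Lemma mem_dipath u p v w : dipath u p v ->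
  (w \in u :: map hd p) = (w \in rcons (map tl p) v).
Proof.
elim: p u => [|d p IHp] u /=; first by move/eqP->.
by case/andP=> /eqP<- /IHp; rewrite !in_cons => ->.
Qed.

Lemma dipath_cycle d p :
  cycle [rel d1 d2 | hd d1 == tl d2] (d :: p) = dipath (hd d) p (tl d).
Proof.
suff H d0 : path [rel d1 d2 | hd d1 == tl d2] d0 (rcons p d)
            = dipath (hd d0) p (tl d) by apply: H.
by elim: p d0 => [|d1 p IHp] d0 /=; rewrite ?andbT // IHp eq_sym.
Qed.

Lemma dipath_reach M u p v : {subset p <= M} -> dipath u p v -> reach Oref M u v.
Proof.
elim: p u => [|d p IHp] u /= pM; first by move/eqP->; apply: reach_refl.
case/andP=> /eqP<- /IHp IH; apply: reach_trans (reach_arc _ _) (IH _).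
  by apply: pM; rewrite mem_head.
by move=> d' pd'; apply: pM; rewrite in_cons pd' orbT.
Qed.

(** [rcons (map tl p) v] lists all vertices of the walk, so its uniqueness says that the path is
    simple, end included. *)
Lemma reach_dipath M u v : reach Oref M u v ->
  exists p, [/\ {subset p <= M}, dipath u p v & uniq (rcons (map tl p) v)].
Proof.
case/connectP=> q Mq ->; case/shortenP: Mq => {}q Mq Uq _.
suff [p [pM pv pE]] : exists p,
    [/\ {subset p <= M}, dipath u p (last u q)
      & rcons (map tl p) (last u q) = u :: q].
  by exists p; split; rewrite ?pE.
elim: q u Mq {Uq} => [|w q IHq] u /=; first by exists [::]; split=> /=.
case/andP=> /arcP[d dM [<- hw]] /IHq[p [pM pw pE]].
exists (d :: p); split=> [d'||] /=; rewrite ?hw ?eqxx ?pE //.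
by rewrite in_cons => /predU1P[->//|/pM].
Qed.

(** If the edge of the first arc recurred later, the tail of that arc would be an end of the later
    arc, hence a repeated vertex. *)
Lemma dipath_uniq_edges u p v :
  dipath u p v -> uniq (rcons (map tl p) v) -> uniq (map fst p).
Proof.
elim: p u => //= d p IHp u /andP[_ pv] /andP[tp Up].
rewrite (IHp _ pv Up) andbT; apply: contra tp => /mapP[d' pd' /esym E].
have hp : hd d' \in rcons (map tl p) v.
  by rewrite -(mem_dipath _ pv) in_cons map_f ?orbT.
have tp : tl d' \in rcons (map tl p) v by rewrite mem_rcons in_cons map_f ?orbT.
by case: (diredge_eqVopp E) => ->; rewrite ?dtail_opp.
Qed.

End SimplePaths.

Section Activities.

Variables (G : multigraph) (Oref : ref_orientation G) (le : rel (edge G)).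
Hypothesis le_order : total_order le.
Implicit Types (O M : fourientation G) (e f : edge G) (d : diredge G).

Local Notation tl := (dtail Oref).
Local Notation hd := (dhead Oref).

Definition above e : {set edge G} := [set f | le e f && (f != e)].
Definition below e : {set edge G} := [set f | le f e && (f != e)].

(** Neither [cycle_arcs] nor [cut_arcs] contains an arc of [e], so both are independent of the state
    of [e] in [O]. *)
Definition cycle_arcs O e : fourientation G := O :&: both_dirs (above e).
Definition cut_arcs O e : fourientation G :=
  cycle_arcs O e :|: both_dirs (below e).

Lemma mem_above e f : (f \in above e) = (e \in below f).
Proof. by rewrite !inE eq_sym. Qed.

Lemma below_irr e : (e \in below e) = false.
Proof. by rewrite inE eqxx andbF. Qed.

Lemma below_trans e f g : f \in below e -> g \in below f -> g \in below e.
Proof.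
case: le_order => _ anti tr _; rewrite !inE => /andP[fe nfe] /andP[gf ngf].
rewrite (tr _ _ _ gf fe); apply: contra ngf => /eqP ge; rewrite ge in gf *.
by apply/eqP/anti; rewrite gf.
Qed.

Lemma below_asym e f : f \in below e -> e \in below f -> False.
Proof. by move=> fe ef; have := below_trans fe ef; rewrite below_irr. Qed.

Lemma below_total e f : [\/ f = e, f \in below e | e \in below f].
Proof.
case: le_order => _ _ _ tot; have [->|ne] := eqVneq f e; first by constructor 1.
by case/orP: (tot f e) => fe; [constructor 2|constructor 3]; rewrite inE fe // eq_sym.
Qed.

Lemma not_below e f : (f \notin below e) = le e f.
Proof.
case: le_order => refl anti _ tot; rewrite inE; have [->|] := eqVneq f e.
  by rewrite andbF refl.
rewrite andbT; case: (boolP (le f e)) => [fe ne|nfe _].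
  by apply/esym/negbTE; apply: contra ne => ef; apply/eqP/anti; rewrite fe.
by have := tot e f; rewrite (negPf nfe) orbF => ->.
Qed.

(** Minty's argument: a potential cut with minimum [d.1] comes from a vertex set that no arc of
    [cut_arcs] enters. Conversely the vertices unreachable from the head of [d] form such a set, and
    a bond inside its boundary is the cut. *)
Lemma min_in_potential_cutP O d : d \in O -> opp d \notin O ->
  min_in_potential_cut Oref le O d.1 <->
  ~~ reach Oref (cut_arcs O d.1) (hd d) (tl d).
Proof.
move=> dO odO; split.
  case=> D [[[X [_ DE]] potD] [/imsetP[d' d'D E] minD]].
  have dD : d \in D.
    case: (diredge_eqVopp E) => d'E; rewrite d'E // in d'D.
    by have := potD _ d'D; rewrite oppK dO.
  have := dD; rewrite DE inE => /andP[tX hX].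
  apply: contraL tX => ht.
  (* If [c] entered [X], then [opp c] would be in [D], so [c] would not be in [O] and its edge would
     be below the minimum [d.1]. *)
  apply: (reach_closed (Y := [predC X]) _ ht hX) => c cR /= tcX.
  apply/negP => hcX.
  have ocD : opp c \in D by rewrite DE inE dtail_opp dhead_opp tcX andbT.
  have := potD _ ocD; rewrite oppK => ncO.
  have : le d.1 c.1 by apply: minD; apply/imsetP; exists (opp c).
  move: cR; rewrite !in_setU !inE (negPf ncO) /= => /andP[cd ne] dc.
  case: le_order => _ anti _ _; case/eqP: ne; apply: anti; by rewrite cd.
move=> ht; pose X := [set y | ~~ reach Oref (cut_arcs O d.1) (hd d) y].
have tX : tl d \in X by rewrite inE.
have hX : hd d \notin X by rewrite inE negbK reach_refl.
have [Z [cutZ tZ hZ subZ]] := cut_contains_bond tX hX.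
exists [set d' | (tl d' \in Z) && (hd d' \notin Z)].
have outX d' : tl d' \in Z -> hd d' \notin Z -> opp d' \notin cut_arcs O d.1.
  move=> t' h'; have [] := subZ _ t' h'.
  rewrite [_ \in X]inE [hd d' \in X]inE negbK => t'X h'X.
  apply: contra t'X => oR; apply: reach_trans h'X _.
  by have := reach_arc Oref oR; rewrite dtail_opp dhead_opp.
(* Smaller edges are usable both ways, so none can leave [Z]; this yields the minimality of
   [d.1]. *)
have belowX d' : tl d' \in Z -> hd d' \notin Z -> d'.1 \notin below d.1.
  move=> t' /(outX _ t'); apply: contra => b.
  by rewrite in_setU [_ \in both_dirs _]inE b orbT.
split; first split; first by exists Z.
- move=> d'; rewrite inE => /andP[t' h'].
  case: (below_total d'.1 d.1) => [E|b|b]; last 1 first.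
  + by have := belowX _ t' h'; rewrite b.
  + case: (diredge_eqVopp E) => d'E; first by rewrite d'E.
    by move: t'; rewrite d'E dtail_opp (negPf hZ).
  have := outX _ t' h'; apply: contra => oO.
  rewrite -mem_above in b.
  by rewrite in_setU in_setI oO [_ \in both_dirs _]inE b.
- split; first by apply/imsetP; exists d; rewrite ?inE ?tZ.
move=> f /imsetP[d']; rewrite inE => /andP[t' h'] ->.
by rewrite -not_below belowX.
Qed.

(** Rotating the cycle to start at [d] leaves a walk from head to tail through larger edges;
    conversely a simple path of that kind closes up with [d]. *)
Lemma min_in_potential_cycleP O d : d \in O -> opp d \notin O ->
  min_in_potential_cycle Oref le O d.1 <->
  reach Oref (cycle_arcs O d.1) (hd d) (tl d).
Proof.
move=> dO odO; split.
  case=> D [[[p [_ cp _ Up DE]] potD] [/imsetP[d' d'D E] minD]].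
  have dD : d \in D.
    case: (diredge_eqVopp E) => d'E; rewrite d'E // in d'D.
    by have := potD _ d'D; rewrite (negPf odO).
  have dp : d \in p by rewrite DE inE in dD.
  have [i q rotE] := rot_to dp.
  have memq c : c \in q -> c \in D.
    by move=> cq; rewrite DE inE -(mem_rot i) rotE in_cons cq orbT.
  move: cp Up; rewrite -(rot_cycle i) -(rot_uniq i) -map_rot rotE dipath_cycle.
  move=> qd /= /andP[dq _]; apply: dipath_reach qd => c cq.
  rewrite in_setI potD ?memq //= !inE minD; last by apply/imset_f/memq.
  by apply: contra dq => /eqP <-; apply: map_f.
case/reach_dipath => p [pQ dp Up].
exists [set d' in d :: p]; split; first split.
- exists (d :: p); split=> //; first by rewrite dipath_cycle.
    by rewrite /= -rcons_uniq.
  rewrite /= (dipath_uniq_edges dp Up) andbT; apply/mapP => -[c /pQ].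
  by rewrite !inE => /and3P[_ _ /eqP nc] /esym.
- by move=> c; rewrite inE in_cons => /predU1P[->//|/pQ]; rewrite inE => /andP[].
split; first by apply/imsetP; exists d; rewrite // inE mem_head.
move=> f /imsetP[c + ->]; rewrite inE in_cons => /predU1P[->|/pQ].
  by case: le_order.
by rewrite !inE => /and3P[].
Qed.

End Activities.

(** * Contracting or deleting the largest edge *)

Section Elimination.

Variables (G : multigraph) (Oref : ref_orientation G) (le : rel (edge G)).
Hypothesis le_order : total_order le.
Variables su sb : edge G -> bool.
Implicit Types (O M N P : fourientation G) (e f : edge G) (d c : diredge G).

Local Notation tl := (dtail Oref).
Local Notation hd := (dhead Oref).
Local Notation reach := (reach Oref).
Local Notation below := (below le).
Local Notation above := (above le).
Local Notation cut_arcs := (cut_arcs le).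
Local Notation cycle_arcs := (cycle_arcs le).
Local Notation dirs e := (both_dirs [set e]).

Definition one_way M d := reach M (tl d) (hd d) && ~~ reach M (hd d) (tl d).

(* This is how a failure to preserve the activity of [d.1] forces a direction on
   the eliminated edge, whose ends are [p] and [q]. *)
Lemma one_wayU1 M d p q :
    reach M (hd d) p -> reach M q (tl d) -> ~~ reach M (hd d) (tl d) ->
  reach (d |: M) q p /\ ~~ reach (d |: M) p q.
Proof.
move=> up qv nuv; rewrite !reachU1 qv up /= orbT; split=> //.
apply/norP; split.
  by apply: contra nuv => pq; apply/(reach_trans up)/(reach_trans pq).
by apply: contra nuv => /andP[pv _]; apply: reach_trans pv.
Qed.

(** Going through [c] and back returns to the same vertex, so one passage in one direction is
    enough. *)
Lemma reach_addU2 M c u v : reach (c |: (opp c |: M)) u v ->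
  reach M u v \/ exists c',
    [/\ c' = c \/ c' = opp c, reach M u (tl c') & reach M (hd c') v].
Proof.
rewrite !reachU1 dtail_opp dhead_opp !reach_refl !andbT /=.
case/orP=> [/orP[|/andP[uh tv]]|/andP[/orP[ut|uh] /orP[hv|tv]]]; first by left.
- by right; exists (opp c); rewrite dtail_opp dhead_opp; split; auto.
- by right; exists c; split; auto.
- by left; apply: reach_trans tv.
- by left; apply: reach_trans hv.
by right; exists (opp c); rewrite dtail_opp dhead_opp; split; auto.
Qed.

(** The walk must use [opp c]. Closing it up with [d] connects the tail of [c] to its head; a
    connection back would already link the head of [d] to its tail in [M]. *)
Lemma one_way_of_contraction M d c :
    reach (opp c |: (c |: M)) (hd d) (tl d) -> ~~ reach (c |: M) (hd d) (tl d) ->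
  one_way (d |: M) c.
Proof.
rewrite -{2}[c]oppK => both; rewrite reachU1 => /norP[nuv nc].
have [uv|[c' [[]-> ut hv]]] := reach_addU2 both.
- by rewrite uv in nuv.
- rewrite dtail_opp dhead_opp in ut hv.
  by apply/andP; apply: one_wayU1.
by rewrite oppK in ut hv; rewrite ut hv in nc.
Qed.

Lemma one_way_of_deletion M d c :
    reach (c |: M) (hd d) (tl d) -> ~~ reach M (hd d) (tl d) ->
  one_way (d |: M) (opp c).
Proof.
rewrite reachU1 => /orP[->//|/andP[ut hv]] nuv.
by apply/andP; rewrite dtail_opp dhead_opp; apply: one_wayU1.
Qed.

(* The chain of arc sets: the [cycle_link O f], contained in [O], grow as [f]
   decreases; the [cut_link O f], containing [O], grow as [f] increases. *)
Definition cut_link O f : fourientation G :=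
  cut_arcs O f :|: O :&: dirs f
  :|: [set d | (d == (f, su f)) && (f \in unoriented O)].

(** Removing the labelled arc of a bioriented [f] mirrors condition (4) on activities, as adding one
    in [cut_link] mirrors condition (3). *)
Definition cycle_link O f : fourientation G :=
  (cycle_arcs O f :|: O :&: dirs f)
  :\: [set d | (d == (f, sb f)) && (f \in bioriented O)].

Definition away e O : fourientation G := O :\: dirs e.

Definition link O e N := exists2 f, f \in below e &
  N = cut_link (away e O) f \/ N = cycle_link (away e O) f.

Lemma cut_link_sup O f : O \subset cut_link O f.
Proof.
apply/subsetP => d dO; rewrite /cut_link !in_setU !in_setI dO /= ![_ \in both_dirs _]inE.
rewrite mem_above in_set1.
by case: (below_total le_order d.1 f) => ->; rewrite ?eqxx ?orbT.
Qed.

Lemma cycle_link_sub O f : cycle_link O f \subset O.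
Proof. by apply: subset_trans (subsetDl _ _) _; rewrite subUset !subsetIl. Qed.

Lemma cut_link_mono O f f' : f \in below f' -> cut_link O f \subset cut_link O f'.
Proof.
move=> ff'; have sO := subsetP (cut_link_sup O f').
have sb' : both_dirs (below f') \subset cut_link O f'.
  by rewrite /cut_link /cut_arcs -!setUA setUCA subsetUl.
rewrite {1}/cut_link {1}/cut_arcs /cycle_arcs !subUset -!andbA.
apply/and4P; split; first by apply/subsetP => d /setIP[/sO].
- apply: subset_trans sb'; apply/subsetP => d.
  by rewrite ![_ \in both_dirs _]inE; apply: (below_trans le_order ff').
- by apply/subsetP => d /setIP[/sO].
apply: subset_trans sb'; apply/subsetP => d; rewrite inE => /andP[/eqP-> _].
by rewrite inE.
Qed.

Lemma cycle_link_mono O f f' :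
  f \in below f' -> cycle_link O f' \subset cycle_link O f.
Proof.
move=> ff'; apply/subsetP => d; rewrite !in_setD !in_setU !in_setI.
case/andP=> nd dO'; have [dO af] : d \in O /\ d.1 \in above f.
  case/orP: dO' => /andP[-> +]; rewrite inE => h; split=> //.
    move: h; rewrite !mem_above => h; exact: (below_trans le_order h ff').
  by rewrite inE in h; rewrite (eqP h) mem_above.
rewrite dO [d \in both_dirs _]inE af /= andbT; apply/negP; rewrite inE.
case/andP=> /eqP dE _; move: af; rewrite dE mem_above below_irr //.
Qed.

Lemma link_total O e N N' :
  link O e N -> link O e N' -> N \subset N' \/ N' \subset N.
Proof.
have sub f f' := subset_trans (cycle_link_sub (away e O) f) (cut_link_sup _ f').
case=> f fe [] -> [f' f'e [] ->]; auto.
  case: (below_total le_order f' f) => [->|h|h]; first by left.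
    by left; apply: cut_link_mono.
  by right; apply: cut_link_mono.
case: (below_total le_order f' f) => [->|h|h]; first by left.
  by right; apply: cycle_link_mono.
by left; apply: cycle_link_mono.
Qed.

(** The direction shared by all links that connect the ends of [e] one way only; false by default
    when there is no such link. *)
Definition forward O e : bool :=
  [exists f in below e, one_way (cut_link (away e O) f) (e, true)
                     || one_way (cycle_link (away e O) f) (e, true)].

Lemma forwardP O e :
  reflect (exists2 N, link O e N & one_way N (e, true)) (forward O e).
Proof.
apply: (iffP existsP) => [[f /andP[fe /orP[]ow]]|[N [f fe []->] ow]].
- by exists (cut_link (away e O) f) => //; exists f; auto.
- by exists (cycle_link (away e O) f) => //; exists f; auto.
- by exists f; rewrite fe ow.
by exists f; rewrite fe ow orbT.
Qed.

(** Of two links with opposite directions, the larger one would connect the ends both ways. *)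
Lemma forward_one_way O e N : link O e N -> ~~ one_way N (e, ~~ forward O e).
Proof.
move=> lN; have [/forwardP[N' lN' /andP[th nht]]|nF] := boolP (forward O e).
  apply/negP => /andP[ht nth].
  have [sub|sub] := link_total lN lN'.
    by rewrite (reach_sub sub ht) in nht.
  by rewrite (reach_sub sub th) in nth.
by apply: contra nF => ow; apply/forwardP; exists N.
Qed.

(** Testing the positive direction suffices: once the larger edges are settled, [cut_arcs] and
    [cycle_arcs] are closed under reversal. *)
Definition cut_active O e : bool :=
  ~~ reach (cut_arcs O e) (rhead Oref e) (rtail Oref e).

Definition cycle_active O e : bool :=
  reach (cycle_arcs O e) (rhead Oref e) (rtail Oref e).

(* [e] belongs to phi(O) when it is oriented with sign [phi_sign O e]. *)
Definition phi_sign O e : bool :=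
  if cut_active O e then true
  else if cycle_active O e then false else ~~ forward O e.

Definition contracted O e : bool :=
  [&& ~~ cut_active O e, ~~ cycle_active O e & (e, phi_sign O e) \in O].

Definition eliminate e O : fourientation G :=
  if contracted O e then O :|: dirs e else away e O.

Lemma dirsE e s : dirs e = [set (e, s); (e, ~~ s)].
Proof.
apply/setP=> -[f t]; rewrite !inE /= !xpair_eqE -andb_orr.
by case: s t => [] []; rewrite andbT.
Qed.

(** [M] stands for the arcs outside [e] that test the activity of the smaller edge [d.1]. If [e] is
    active, its arcs make no difference. Otherwise a changed outcome would make the link [d |: M]
    one-way along [c], which the choice of [forward] excludes. *)
Lemma eliminate_reach O e M d :
    (forall c, c.1 \in above e -> c \in O -> opp c \in O) ->
    d.1 \in below e -> link O e (d |: M) ->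
    cycle_arcs O e \subset M -> M \subset cut_arcs O e ->
  reach (M :|: O :&: dirs e) (hd d) (tl d) =
  reach (M :|: eliminate e O :&: dirs e) (hd d) (tl d).
Proof.
move=> symO de lN subM supM; set c := (e, phi_sign O e).
have cutsym : symmetric (reach (cut_arcs O e)).
  apply: reach_sym => b; rewrite !inE /= => /orP[/andP[bO ba]|->]; last exact: orbT.
  by rewrite symO ?inE ?ba.
have cycsym : symmetric (reach (cycle_arcs O e)).
  by apply: reach_sym => b; rewrite !inE /= => /andP[bO ba]; rewrite symO ?inE ?ba.
have ac : away e O :&: dirs e = set0.
  by apply/setP=> b; rewrite !inE andbAC andNb.
have [act|nact] := boolP (cut_active O e || cycle_active O e).
  have nc : contracted O e = false.
    by rewrite /contracted andbA -negb_or act.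
  rewrite /eliminate nc ac setU0; apply/idP/idP; last first.
    exact/reach_sub/subsetUl.
  have sub : M :|: O :&: dirs e \subset c |: (opp c |: M).
    rewrite setUA setUC; apply: setSU; rewrite (dirsE e (phi_sign O e)).
    exact: subsetIr.
  case/(reach_sub sub)/reach_addU2=> // -[c' [c'E ut hv]].
  have {c'E} [s c'E] : exists s, c' = (e, s).
    by case: c'E => ->; [exists (phi_sign O e) | exists (~~ phi_sign O e)].
  (* If [e] is cut active, a walk through [c'] closes up via [d], whose edge is below [e], a
     contradiction. If it is cycle active, [M] already joins its ends. *)
  case/orP: act => [/negP[]|act].
    have : reach (cut_arcs O e) (hd c') (tl c').
      apply: reach_trans (reach_sub supM hv) _.
      apply: reach_trans (reach_sub supM ut); apply: reach_arc.
      by rewrite in_setU orbC inE de.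
    by rewrite c'E; case: (s) => //; rewrite cutsym.
  suff th : reach M (tl c') (hd c') by apply: reach_trans (reach_trans ut th) hv.
  apply: reach_sub subM _; move: act; rewrite /cycle_active c'E.
  by case: (s) => //; rewrite cycsym.
have cF : c = (e, ~~ forward O e).
  by move: nact; rewrite /c /phi_sign; case: cut_active; case: cycle_active.
have contrE : contracted O e = (c \in O).
  by rewrite /contracted andbA -negb_or nact.
have nway : ~~ one_way (d |: M) c by rewrite cF forward_one_way.
have eq_opp : (c == opp c) = false.
  by rewrite /opp /c /= xpair_eqE eqxx; case: (phi_sign O e).
have OdE : O :&: dirs e
    = (if c \in O then [set c] else set0)
        :|: (if opp c \in O then [set opp c] else set0).
  apply/setP=> b; rewrite in_setI in_setU (dirsE e (phi_sign O e)) in_set2.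
  have ifE (x : diredge G) :
      (b \in (if x \in O then [set x] else set0)) = (x \in O) && (b == x).
    by case: ifP; rewrite inE.
  rewrite !ifE -/(opp c) -/c.
  have [->|_] := eqVneq b c; first by rewrite eq_opp !andbT andbF orbF.
  by have [->|] := eqVneq b (opp c); rewrite ?andbT ?andbF.
have full : (O :|: dirs e) :&: dirs e = dirs e by rewrite setIC setKU.
(* Bioriented and unoriented states are reproduced exactly. With [c] alone, contraction adds
   [opp c]; with [opp c] alone, deletion removes it. *)
rewrite /eliminate contrE OdE; case: ifP => cO; case: ifP => ocO;
  rewrite ?full ?ac ?setU0 ?set0U //.
- by rewrite (dirsE e (phi_sign O e)).
- rewrite setUC (dirsE e (phi_sign O e)) -/c -/(opp c); apply/idP/idP.
    by apply: reach_sub; rewrite setUC; apply/setUS/subsetUl.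
  have -> : M :|: [set c; opp c] = opp c |: (c |: M).
    by rewrite setUA setUC [[set opp c] :|: _]setUC.
  by move=> both; apply: contraR nway; apply: one_way_of_contraction.
rewrite setUC; apply/idP/idP; last exact/reach_sub/subsetUr.
move=> del; apply: contraR nway => nM.
by rewrite -[c]oppK; apply: one_way_of_deletion.
Qed.

End Elimination.

(** * Eliminating all edges in decreasing order *)

Section Stages.

Variables (G : multigraph) (Oref : ref_orientation G) (le : rel (edge G)).
Hypothesis le_order : total_order le.
Variables su sb : edge G -> bool.
Implicit Types (O M N P : fourientation G) (e f : edge G) (d c : diredge G).
Implicit Types (s : seq (edge G)).

Local Notation tl := (dtail Oref).
Local Notation hd := (dhead Oref).
Local Notation reach := (reach Oref).
Local Notation below := (below le).
Local Notation above := (above le).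
Local Notation cut_arcs := (cut_arcs le).
Local Notation cycle_arcs := (cycle_arcs le).
Local Notation dirs e := (both_dirs [set e]).
Local Notation eliminate := (eliminate Oref le su sb).
Local Notation cut_active := (cut_active Oref le).
Local Notation cycle_active := (cycle_active Oref le).

(** For [e] in [s], the fourientation met by [e]: the edges preceding it are eliminated, [e] is
    not. *)
Fixpoint stage s O e : fourientation G :=
  if s is f :: s' then if f == e then O else stage s' (eliminate f O) e else O.

(** Such a list enumerates a down-closed set of edges from the largest to the smallest. *)
Fixpoint descending s : Prop :=
  if s is e :: s' then (forall f, (f \in s') = (f \in below e)) /\ descending s'
  else True.

Lemma in_away f O d : (d \in away f O) = (d.1 != f) && (d \in O).
Proof. by rewrite !inE. Qed.

Lemma away_eliminate f O : away f (eliminate f O) = away f O.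
Proof.
apply/setP=> d; rewrite !in_away /eliminate; case: ifP => _.
  by rewrite !inE; case: eqP; rewrite ?orbF.
by rewrite in_away; case: eqP.
Qed.

Lemma eliminate_neq f O d : d.1 != f -> (d \in eliminate f O) = (d \in O).
Proof.
by move=> df; have := in_away f O d; rewrite -away_eliminate in_away df /=.
Qed.

Lemma cycle_arcs_split e f O : f \in above e ->
  cycle_arcs O e = cycle_arcs (away f O) e :|: O :&: dirs f.
Proof.
move=> fe; apply/setP=> d.
rewrite in_setU !in_setI in_away ![_ \in both_dirs _]inE in_set1.
by have [->|_] := eqVneq d.1 f; rewrite ?fe ?andbT ?andbF ?orbF.
Qed.

Lemma cut_arcs_split e f O : f \in above e ->
  cut_arcs O e = cut_arcs (away f O) e :|: O :&: dirs f.
Proof.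
by move=> fe; rewrite /cut_arcs (cycle_arcs_split _ fe) setUAC.
Qed.

Lemma cycle_arcs_away e f O : e \in below f ->
  cycle_arcs O f \subset cycle_arcs (away f O) e.
Proof.
move=> ef; apply/subsetP => d; rewrite !in_setI in_away ![_ \in both_dirs _]inE.
rewrite !mem_above => /andP[-> fd]; rewrite (below_trans le_order fd ef) !andbT.
by apply: contraTneq fd => ->; rewrite below_irr.
Qed.

Lemma cut_arcs_away e f O : e \in below f ->
  cut_arcs (away f O) e \subset cut_arcs O f.
Proof.
move=> ef; apply/subsetP => d; rewrite !in_setU !in_setI in_away.
rewrite ![_ \in both_dirs _]inE => /orP[/andP[/andP[df dO] _]|].
  rewrite dO mem_above /=.
  have [E|->|->] := below_total le_order d.1 f; rewrite ?orbT //.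
  by rewrite E eqxx in df.
by move/(below_trans le_order ef) => ->; rewrite orbT.
Qed.

(* The direction in which [d.1] would be used by a potential cut (resp. cycle)
   witnessing its activity, once an unoriented (resp. bioriented) edge has been
   replaced according to its sign label. *)
Definition cut_dir O d : bool :=
  if d.1 \in unoriented O then d.2 == su d.1
  else (d.1 \notin bioriented O) && (d \in O).

Definition cycle_dir O d : bool :=
  (d \in O) && ((d.1 \in bioriented O) ==> (d.2 != sb d.1)).

(** Shows that adding [d] to the arcs testing the activity of [e] gives a link, as [eliminate_reach]
    requires. *)
Lemma cut_link_dir e f O d : d.1 = e -> f \in above e -> cut_dir O d ->
  cut_link le su (away f O) e = d |: cut_arcs (away f O) e.
Proof.
case: d => _ t /= -> fe; rewrite /cut_dir /cut_link /=.
have nef : e != f by apply: contraTneq fe => ->; rewrite mem_above below_irr.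
move=> dirt; apply/setP=> -[g r].
rewrite !in_setU !in_setI in_away ![_ \in both_dirs _]inE.
rewrite !in_set1 [X in _ || X = _]in_set !xpair_eqE /=.
have [->|_] := eqVneq g e; last by rewrite /= ?andbF ?orbF.
move: dirt; rewrite mem_above below_irr !inE /= !nef.
by case: (su e); case: t; case: r; case: ((e, true) \in O);
  case: ((e, false) \in O).
Qed.

Lemma cycle_link_dir e f O d : d.1 = e -> f \in above e -> cycle_dir O d ->
  cycle_link le sb (away f O) e = d |: cycle_arcs (away f O) e.
Proof.
case: d => _ t /= -> fe; rewrite /cycle_dir /cycle_link /=.
have nef : e != f by apply: contraTneq fe => ->; rewrite mem_above below_irr.
move=> dirt; apply/setP=> -[g r].
rewrite in_setD !in_setU !in_setI in_away ![_ \in both_dirs _]inE.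
rewrite !in_set1 [X in ~~ X && _]in_set !xpair_eqE /=.
have [->|_] := eqVneq g e; last by rewrite /= ?andbF ?orbF.
move: dirt; rewrite mem_above below_irr !inE /= !nef.
by case: (sb e); case: t; case: r; case: ((e, true) \in O);
  case: ((e, false) \in O).
Qed.

(** This is [eliminate_reach] with [M = cut_arcs (away f O) e], which lies between [cycle_arcs O f]
    and [cut_arcs O f] because [e] is below [f]. *)
Lemma eliminate_cut_active e f O d :
    (forall c, c.1 \in above f -> c \in O -> opp c \in O) ->
    d.1 = e -> e \in below f -> cut_dir O d ->
  reach (cut_arcs O e) (hd d) (tl d)
    = reach (cut_arcs (eliminate f O) e) (hd d) (tl d).
Proof.
move=> symO d1 ef dirO; have fe : f \in above e by rewrite mem_above.
rewrite (cut_arcs_split _ fe) [in RHS](cut_arcs_split _ fe) away_eliminate.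
apply: eliminate_reach => //; first by rewrite d1.
- by exists e => //; left; rewrite (cut_link_dir d1 fe dirO).
- by apply: subset_trans (cycle_arcs_away O ef) _; apply: subsetUl.
exact: cut_arcs_away.
Qed.

Lemma eliminate_cycle_active e f O d :
    (forall c, c.1 \in above f -> c \in O -> opp c \in O) ->
    d.1 = e -> e \in below f -> cycle_dir O d ->
  reach (cycle_arcs O e) (hd d) (tl d)
    = reach (cycle_arcs (eliminate f O) e) (hd d) (tl d).
Proof.
move=> symO d1 ef dirO; have fe : f \in above e by rewrite mem_above.
rewrite (cycle_arcs_split _ fe) [in RHS](cycle_arcs_split _ fe) away_eliminate.
apply: eliminate_reach => //; first by rewrite d1.
- by exists e => //; right; rewrite (cycle_link_dir d1 fe dirO).
- exact: cycle_arcs_away.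
by apply: subset_trans (cut_arcs_away O ef); apply: subsetUl.
Qed.

Lemma cut_dir_eliminate f O d : d.1 != f ->
  cut_dir (eliminate f O) d = cut_dir O d.
Proof. by move=> df; rewrite /cut_dir !inE !eliminate_neq. Qed.

Lemma cycle_dir_eliminate f O d : d.1 != f ->
  cycle_dir (eliminate f O) d = cycle_dir O d.
Proof. by move=> df; rewrite /cycle_dir !inE !eliminate_neq. Qed.

(* Edges outside [s] have already been contracted or deleted. *)
Definition settled s O := forall c, c.1 \notin s -> c \in O -> opp c \in O.

Lemma settled_eliminate f s O : settled (f :: s) O -> settled s (eliminate f O).
Proof.
move=> sO c cs; have [cf|cf] := eqVneq c.1 f.
  rewrite /eliminate; case: ifP => _; last by rewrite in_away cf eqxx.
  by rewrite !inE /= cf eqxx !orbT.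
by rewrite !eliminate_neq //; apply: sO; rewrite in_cons negb_or cf.
Qed.

Lemma settled_above f s O c : descending (f :: s) -> settled (f :: s) O ->
  c.1 \in above f -> c \in O -> opp c \in O.
Proof.
move=> /= [sE _] sO fc; apply: sO; rewrite in_cons sE negb_or.
rewrite mem_above in fc; apply/andP; split.
  by apply: contraTneq fc => ->; rewrite below_irr.
by apply/negP; apply: below_asym fc.
Qed.

(** Each elimination ahead of [d.1] preserves the test. At [d.1] all larger edges are settled, and
    symmetry reconciles [d] with the positive direction in [cut_active]. *)
Lemma stage_cut_active s O d : descending s -> settled s O -> d.1 \in s ->
    cut_dir O d ->
  cut_active (stage s O d.1) d.1 = ~~ reach (cut_arcs O d.1) (hd d) (tl d).
Proof.
elim: s O => // f s IHs O ds sO; have symO c := settled_above (c := c) ds sO.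
rewrite in_cons /= [f == _]eq_sym; have [df _ _|df /= dsn dirO] := eqVneq.
  rewrite /cut_active; case: d df {IHs} => e [] /= -> //.
  suff sym : symmetric (reach (cut_arcs O f)) by rewrite sym.
  apply: reach_sym => b; rewrite !in_setU !in_setI ![_ \in both_dirs _]inE /=.
  by case/orP=> [/andP[bO bf]|->]; rewrite ?orbT // bf symO.
have db : d.1 \in below f by case: ds => <-.
rewrite (IHs _ (proj2 ds) (settled_eliminate sO) dsn) ?cut_dir_eliminate //.
by rewrite (eliminate_cut_active symO).
Qed.

Lemma stage_cycle_active s O d : descending s -> settled s O -> d.1 \in s ->
    cycle_dir O d ->
  cycle_active (stage s O d.1) d.1 = reach (cycle_arcs O d.1) (hd d) (tl d).
Proof.
elim: s O => // f s IHs O ds sO; have symO c := settled_above (c := c) ds sO.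
rewrite in_cons /= [f == _]eq_sym; have [df _ _|df /= dsn dirO] := eqVneq.
  rewrite /cycle_active; case: d df {IHs} => e [] /= -> //.
  suff sym : symmetric (reach (cycle_arcs O f)) by rewrite sym.
  apply: reach_sym => b; rewrite !in_setI ![_ \in both_dirs _]inE.
  by case/andP=> bO bf; rewrite bf symO.
have db : d.1 \in below f by case: ds => <-.
rewrite (IHs _ (proj2 ds) (settled_eliminate sO) dsn) ?cycle_dir_eliminate //.
by rewrite (eliminate_cycle_active symO).
Qed.

End Stages.

(** * Activity maps obtained from the elimination *)

Section ActivityMaps.

Variables (G : multigraph) (Oref : ref_orientation G) (le : rel (edge G)).
Hypothesis le_order : total_order le.
Variables su sb : edge G -> bool.
Implicit Types (O : fourientation G) (e f : edge G) (d : diredge G).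
Implicit Types (s : seq (edge G)).

Lemma sorted_descending s : pairwise [rel e f | le f e] s -> uniq s ->
  (forall f g, f \notin s -> g \in s -> g \in below le f) -> descending le s.
Proof.
elim: s => // e s IHs /= /andP[/allP es sorted_s] /andP[nes Us] out.
have sE f : (f \in s) = (f \in below le e).
  apply/idP/idP => [fs|fe].
    by rewrite inE [le f e](es f fs); apply: contraNneq nes => <-.
  apply: contraTT fe => nfs; have [->|fe] := eqVneq f e.
    by rewrite below_irr.
  apply/negP => /(below_asym le_order); apply; apply: out; last exact: mem_head.
  by rewrite in_cons negb_or fe.
split=> //; apply: IHs => // f g nf gs; have [->|fe] := eqVneq f e.
  by rewrite -sE.
by apply: out; rewrite in_cons ?negb_or ?fe ?gs ?orbT.
Qed.

Lemma descending_enum : exists2 s, descending le s & forall e, e \in s.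
Proof.
case: (le_order) => _ _ tr tot.
exists (sort [rel e f | le f e] (enum (edge G))) => [|e]; last first.
  by rewrite mem_sort mem_enum.
have trg : transitive [rel e f | le f e] by move=> a b c /= ba cb; apply: tr cb ba.
apply: sorted_descending => [||f g]; last by rewrite mem_sort mem_enum.
  by rewrite -(sorted_pairwise trg) sort_sorted // => a b; apply: tot.
by rewrite sort_uniq enum_uniq.
Qed.

Variable s : seq (edge G).
Hypotheses (descs : descending le s) (alls : forall e, e \in s).

Local Notation stage := (stage Oref le su sb s).

(** The conditions constrain [I] only on oriented and unoriented edges, and [L] only on oriented and
    bioriented ones; testing after elimination gives values on all edges. *)
Definition cut_activity O : {set edge G} :=
  [set e | cut_active Oref le (stage O e) e].

Definition cycle_activity O : {set edge G} :=
  [set e | cycle_active Oref le (stage O e) e].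

Definition phi_map O : {set edge G} :=
  [set e | (e, phi_sign Oref le su sb (stage O e) e) \in O].

Lemma settled_all O : settled s O.
Proof. by move=> c; rewrite alls. Qed.

Lemma mem_oriented O e :
  (e \in oriented O) = (((e, true) \in O) (+) ((e, false) \in O)).
Proof. by rewrite !inE; case: (_ \in O); case: (_ \in O). Qed.

Lemma orientedE O e :
  (e \in oriented O) = (e \notin unoriented O) && (e \notin bioriented O).
Proof. by rewrite in_setC in_setU negb_or. Qed.

Lemma cut_activitiesP : cut_activities Oref le su cut_activity.
Proof.
move=> O; split=> e; rewrite in_setI inE.
  have [eo|_] := boolP (e \in oriented O); last by rewrite andbF; split=> // -[].
  pose d := (e, (e, true) \in O).
  have dO : d \in O.
    by move: eo; rewrite mem_oriented /d; case E: ((e, true) \in O).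
  have odO : opp d \notin O.
    move: eo; rewrite mem_oriented /d /opp.
    by case E: ((e, true) \in O) => //=; rewrite E.
  have dird : cut_dir su O d.
    move: eo; rewrite /cut_dir /= orientedE => /andP[/negPf-> ->].
    by rewrite dO.
  rewrite -[e]/(d.1).
  rewrite (stage_cut_active Oref le_order sb descs (@settled_all O) (alls _) dird).
  rewrite andbT -(min_in_potential_cutP Oref le_order dO odO).
  by split=> [|[]].
have [eu|_] := boolP (e \in unoriented O); last by rewrite andbF; split=> // -[].
pose d := (e, su e).
have odO : opp d \notin d |: O.
  rewrite in_setU1 /opp /d /= xpair_eqE eqxx /=; move: eu; rewrite inE.
  by case: (su e) => /andP[].
have dird : cut_dir su O d by rewrite /cut_dir eu /=.
rewrite -[cut_active _ _ _ e]/(cut_active _ _ (stage O d.1) d.1)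
  (stage_cut_active Oref le_order sb descs (@settled_all O) (alls _) dird).
(* An arc of [e] does not enter [cut_arcs] at [e], so the reachability criterion can be applied to
   [d |: O]. *)
rewrite andbT; have -> : cut_arcs le O d.1 = cut_arcs le (d |: O) d.1.
  rewrite /cut_arcs /cycle_arcs; congr (_ :|: _); apply/setP=> b.
  rewrite !in_setI in_setU1; have [->|//] := eqVneq b d.
  by rewrite inE mem_above below_irr !andbF.
rewrite -(min_in_potential_cutP Oref le_order (setU11 _ _) odO).
by split=> [|[]].
Qed.

Lemma cycle_activitiesP : cycle_activities Oref le sb cycle_activity.
Proof.
move=> O; split=> e; rewrite in_setI inE.
  have [eo|_] := boolP (e \in oriented O); last by rewrite andbF; split=> // -[].
  pose d := (e, (e, true) \in O).
  have dO : d \in O.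
    by move: eo; rewrite mem_oriented /d; case E: ((e, true) \in O).
  have odO : opp d \notin O.
    move: eo; rewrite mem_oriented /d /opp.
    by case E: ((e, true) \in O) => //=; rewrite E.
  have dird : cycle_dir sb O d.
    move: eo; rewrite /cycle_dir /= orientedE => /andP[_ /negPf->].
    by rewrite dO.
  rewrite -[e]/(d.1).
  rewrite (stage_cycle_active Oref le_order su descs (@settled_all O) (alls _) dird).
  rewrite andbT -(min_in_potential_cycleP Oref le_order dO odO).
  by split=> [|[]].
have [eb|_] := boolP (e \in bioriented O); last by rewrite andbF; split=> // -[].
(* Removing the labelled arc leaves [e] oriented with the opposite sign. *)
pose d := (e, ~~ sb e).
have dO' : d \in O :\ (e, sb e).
  rewrite in_setD1 xpair_eqE eqxx /=; move: eb; rewrite inE /d.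
  by case: (sb e) => /andP[et ef]; rewrite ?et ?ef.
have odO : opp d \notin O :\ (e, sb e).
  by rewrite in_setD1 /opp /d /= negbK eqxx.
have dird : cycle_dir sb O d.
  by rewrite /cycle_dir eb; case/setD1P: dO' => _ -> /=; case: (sb e).
rewrite -[cycle_active _ _ _ e]/(cycle_active _ _ (stage O d.1) d.1)
  (stage_cycle_active Oref le_order su descs (@settled_all O) (alls _) dird).
rewrite andbT.
have -> : cycle_arcs le O d.1 = cycle_arcs le (O :\ (e, sb e)) d.1.
  apply/setP=> b; rewrite !in_setI in_setD1; have [->|//] := eqVneq b (e, sb e).
  by rewrite inE mem_above below_irr !andbF.
rewrite -(min_in_potential_cycleP Oref le_order dO' odO).
by split=> [|[]].
Qed.

End ActivityMaps.

(** * Deletion-contraction for the homogenized Tutte polynomial *)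

Section SubgraphSum.

Import GRing.Theory.
Local Open Scope ring_scope.

Lemma sum_setU1 (T : finType) (V : nmodType) (a : T) (P : pred {set T})
    (F : {set T} -> V) : (forall A, P (a |: A) = P A) ->
  \sum_(A | P A) F A = \sum_(A | P A && (a \notin A)) (F A + F (a |: A)).
Proof.
move=> PU; rewrite (bigID (fun A : {set T} => a \notin A)) big_split /=.
congr (_ + _); rewrite (reindex_onto (fun A => a |: A) (fun A => A :\ a)) /=.
  apply: eq_bigl => A; rewrite PU setU11 andbT; congr (_ && _).
  have [aA|aA] := boolP (a \in A); last by rewrite setU1K ?eqxx.
  by apply/negbTE/eqP => E; rewrite -E !inE eqxx in aA.
by move=> A /andP[_]; rewrite negbK => aA; rewrite setD1K.
Qed.

Variables (G : multigraph) (Oref : ref_orientation G).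
Implicit Types (A B C S : {set edge G}) (e f : edge G) (s : seq (edge G)).

Local Notation joined := (joined Oref).

Definition rank A : nat := (#|vertex G| - kappa A)%N.

Lemma kappa_le A : (kappa A <= #|vertex G|)%N.
Proof. by apply: max_card. Qed.

Lemma rankU1 A e : rank (e |: A) = (rank A + ~~ joined A e)%N.
Proof. by have := kappa_le A; have := kappaU1 Oref A e; rewrite /rank; lia. Qed.

Lemma rank_mono A B : A \subset B -> (rank A <= rank B)%N.
Proof. by move=> sAB; apply/leq_sub2l/(kappaS Oref). Qed.

Lemma rank_bound A B : (rank (A :|: B) <= rank A + #|B|)%N.
Proof.
move: {2}#|B| (leqnn #|B|) => n; elim: n B => [|n IHn] B.
  by rewrite leqn0 cards_eq0 => /eqP->; rewrite setU0 cards0 addn0.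
have [->|[e eB]] := set_0Vmem B; first by rewrite setU0 leq_addr.
rewrite (cardsD1 e) eB add1n ltnS => /IHn.
have -> : A :|: B = e |: (A :|: (B :\ e)) by rewrite setUCA setD1K.
rewrite rankU1; case: joined; lia.
Qed.

Lemma joined_mono A B e : A \subset B -> joined A e -> joined B e.
Proof.
move=> /subsetP sAB; rewrite /joined; apply: connect_sub => u v.
case/existsP=> f /andP[/sAB fB uv]; apply/connect1/existsP; exists f.
by rewrite fB.
Qed.

Variable R : comNzRingType.
Variables P p Q q : R.

(* The terms of the Tutte polynomial of the graph with edge set [s] obtained by
   contracting [C], at the point [(P / p, Q / q)] and cleared of denominators. *)
Definition subgraph_term C s S : R :=
  (P - p) ^+ (rank (C :|: [set f in s]) - rank (C :|: S))
  * p ^+ (rank (C :|: S) - rank C)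
  * (Q - q) ^+ (#|S| + rank C - rank (C :|: S))
  * q ^+ (size s + rank (C :|: S) - (#|S| + rank (C :|: [set f in s]))).

Definition subgraph_sum C s : R :=
  \sum_(S : {set edge G} | S \subset [set f in s]) subgraph_term C s S.

Lemma set_cons e s : [set f in e :: s] = e |: [set f in s].
Proof. by apply/setP=> f; rewrite !inE. Qed.

Lemma subgraph_sum_nil C : subgraph_sum C [::] = 1.
Proof.
have nil0 : [set f in [::]] = set0 :> {set edge G}.
  by apply/setP => f; rewrite !inE.
rewrite /subgraph_sum (big_pred1 set0) => [|S]; last by rewrite nil0 subset0.
rewrite /subgraph_term nil0.
by rewrite !setU0 cards0 !add0n !subnn !expr0 !mulr1.
Qed.

Lemma subgraph_sum_cons C s e : e \notin s ->
  subgraph_sum C (e :: s) =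
  \sum_(S : {set edge G} | S \subset [set f in s])
    (subgraph_term C (e :: s) S + subgraph_term C (e :: s) (e |: S)).
Proof.
move=> es; rewrite /subgraph_sum (sum_setU1 (a := e)) => [|S]; last first.
  by rewrite subUset sub1set inE mem_head.
apply: eq_bigl => S; rewrite set_cons; have [eS|eS] := boolP (e \in S).
  rewrite andbF; apply/esym/negbTE/subsetPn; exists e => //.
  by rewrite inE.
rewrite andbT; apply/subsetP/subsetP => sub f fS; have := sub f fS.
  by rewrite in_setU1 => /predU1P[fe|//]; rewrite -fe fS in eS.
by rewrite in_setU1 orbC => ->.
Qed.

Section Step.

Variables (C : {set edge G}) (s : seq (edge G)) (e : edge G).
Hypotheses (Us : uniq (e :: s)).

(** These inequalities make the truncated subtractions in [subgraph_term] exact. *)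
Let bounds S : S \subset [set f in s] ->
  [/\ (rank C <= rank (C :|: S) <= rank (C :|: [set f in s]))%N,
      (rank (C :|: S) <= rank C + #|S|)%N,
      (rank (C :|: [set f in s]) + #|S| <= rank (C :|: S) + size s)%N
    & (#|e |: S| = #|S|.+1)%N].
Proof.
move=> Ss; have card_s : #|[set f in s]| = size s.
  by rewrite cardsE; apply/card_uniqP; case/andP: Us.
have eS : e \notin S.
  by case/andP: Us => es _; apply: contra es => /(subsetP Ss); rewrite inE.
split; rewrite ?rank_mono ?subsetUl ?setUS ?rank_bound ?cardsU1 ?eS //.
have -> : C :|: [set f in s] = (C :|: S) :|: ([set f in s] :\: S).
  rewrite -setUA; congr (_ :|: _).
  by rewrite setUC setDE setUIl [~: S :|: S]setUC setUCr setIT (setUidPl Ss).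
have := rank_bound (C :|: S) ([set f in s] :\: S); have := cardsD [set f in s] S.
rewrite setIC (setIidPl Ss) card_s; have := subset_leq_card Ss; lia.
Qed.

(** Omitting [e] contributes a factor [P - p] and including it a factor [p], in total [P]. *)
Lemma subgraph_sum_bridge : ~~ joined (C :|: [set f in s]) e ->
  subgraph_sum C (e :: s) = P * subgraph_sum C s.
Proof.
move=> nj; have es : e \notin s by case/andP: Us.
rewrite subgraph_sum_cons // mulr_sumr; apply: eq_bigr => S Ss.
have [/andP[b1 b2] b3 b4 cardS] := bounds Ss.
have njS : ~~ joined (C :|: S) e.
  by apply: contra nj; apply/joined_mono/setUS.
rewrite /subgraph_term set_cons ![C :|: (e |: _)]setUCA !rankU1 nj njS cardS /=.
set r := rank (C :|: S) in b1 b2 b3 b4 *.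
set r1 := rank (C :|: [set f in s]) in b2 b4 *.
set r0 := rank C in b1 b3 *.
have -> : (r1 + 1 - r = (r1 - r).+1)%N by lia.
have -> : (r1 + 1 - (r + 1) = r1 - r)%N by lia.
have -> : (r + 1 - r0 = (r - r0).+1)%N by lia.
have -> : (#|S|.+1 + r0 - (r + 1) = #|S| + r0 - r)%N by lia.
have -> : ((size s).+1 + r - (#|S| + (r1 + 1))
           = size s + r - (#|S| + r1))%N by lia.
have -> : ((size s).+1 + (r + 1) - (#|S|.+1 + (r1 + 1))
           = size s + r - (#|S| + r1))%N by lia.
rewrite !exprS; ring.
Qed.

(** Including [e] contributes [Q - q] and omitting it [q], in total [Q]. *)
Lemma subgraph_sum_loop : joined C e ->
  subgraph_sum C (e :: s) = Q * subgraph_sum C s.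
Proof.
move=> j; have es : e \notin s by case/andP: Us.
rewrite subgraph_sum_cons // mulr_sumr; apply: eq_bigr => S Ss.
have [/andP[b1 b2] b3 b4 cardS] := bounds Ss.
have jU A : joined (C :|: A) e by apply: joined_mono j; apply: subsetUl.
rewrite /subgraph_term set_cons ![C :|: (e |: _)]setUCA !rankU1 !jU cardS /= !addn0.
set r := rank (C :|: S) in b1 b2 b3 b4 *.
set r1 := rank (C :|: [set f in s]) in b2 b4 *.
set r0 := rank C in b1 b3 *.
have -> : (#|S|.+1 + r0 - r = (#|S| + r0 - r).+1)%N by lia.
have -> : ((size s).+1 + r - (#|S| + r1) = (size s + r - (#|S| + r1)).+1)%N by lia.
have -> : ((size s).+1 + r - (#|S|.+1 + r1) = size s + r - (#|S| + r1))%N by lia.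
rewrite !exprS; ring.
Qed.

(** Subsets containing [e] correspond to the contraction and carry an extra [p]; the others
    correspond to the deletion and carry an extra [q]. *)
Lemma subgraph_sum_ordinary :
    joined (C :|: [set f in s]) e -> ~~ joined C e ->
  subgraph_sum C (e :: s) = p * subgraph_sum (e |: C) s + q * subgraph_sum C s.
Proof.
move=> j nj; have es : e \notin s by case/andP: Us.
rewrite subgraph_sum_cons // !mulr_sumr -big_split; apply: eq_bigr => S Ss /=.
have [/andP[b1 b2] b3 b4 cardS] := bounds Ss.
have b5 : (rank (e |: C) <= rank (e |: (C :|: S)))%N.
  by apply/rank_mono/setUS/subsetUl.
have b6 : (rank (e |: (C :|: S)) <= rank (e |: (C :|: [set f in s])))%N.
  by apply/rank_mono/setUS/setUS.
rewrite addrC /subgraph_term set_cons ![C :|: (e |: _)]setUCA.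
rewrite -![(e |: C) :|: _]setUA.
move: b5 b6; rewrite !rankU1 j nj cardS /= !addn0.
set r := rank (C :|: S) in b1 b2 b3 b4 *.
set r1 := rank (C :|: [set f in s]) in b2 b4 *.
set r0 := rank C in b1 b3 *; set i := nat_of_bool _; move=> b5 b6.
have -> : (r + i - r0 = (r + i - (r0 + 1)).+1)%N by lia.
have -> : (#|S|.+1 + r0 - (r + i) = #|S| + (r0 + 1) - (r + i))%N by lia.
have -> : ((size s).+1 + (r + i) - (#|S|.+1 + r1)
           = size s + (r + i) - (#|S| + r1))%N by lia.
have -> : ((size s).+1 + r - (#|S| + r1) = (size s + r - (#|S| + r1)).+1)%N by lia.
rewrite !exprS; ring.
Qed.

End Step.

End SubgraphSum.

(** * Deletion-contraction for the sum over fourientations *)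

Section FourientationSum.

Import GRing.Theory.
Local Open Scope ring_scope.

Variables (G : multigraph) (Oref : ref_orientation G) (le : rel (edge G)).
Hypothesis le_order : total_order le.
Variables su sb : edge G -> bool.
Variables (R : comNzRingType) (k1 k2 l m x w x' w' y z y' z' : R).
Implicit Types (O : fourientation G) (e f : edge G) (s : seq (edge G)).
Implicit Types (C : {set edge G}).

Local Notation dirs e := (both_dirs [set e]).
Local Notation eliminate := (eliminate Oref le su sb).
Local Notation cut_active := (cut_active Oref le).
Local Notation cycle_active := (cycle_active Oref le).
Local Notation phi_sign := (phi_sign Oref le su sb).
Local Notation contracted := (contracted Oref le su sb).
Local Notation stage := (stage Oref le su sb).

Definition weight O e : R :=
    k1 ^+ ((e \in oriented O) && ((e, phi_sign O e) \in O))
  * k2 ^+ ((e \in oriented O) && ((e, phi_sign O e) \notin O))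
  * l ^+ (e \in unoriented O) * m ^+ (e \in bioriented O)
  * x ^+ (cut_active O e && (e \in oriented_pos O))
  * w ^+ (cut_active O e && (e \in oriented_neg O))
  * x' ^+ (cut_active O e && (e \in bioriented O))
  * w' ^+ (cut_active O e && (e \in unoriented O))
  * y ^+ (cycle_active O e && (e \in oriented_pos O))
  * z ^+ (cycle_active O e && (e \in oriented_neg O))
  * y' ^+ (cycle_active O e && (e \in unoriented O))
  * z' ^+ (cycle_active O e && (e \in bioriented O)).

Fixpoint run_weight s O : R :=
  if s is e :: s' then weight O e * run_weight s' (eliminate e O) else 1.

Lemma run_weight_prod s O : uniq s ->
  run_weight s O = \prod_(e <- s) weight (stage s O e) e.
Proof.
elim: s O => [|e s IHs] O /=; first by rewrite big_nil.
case/andP=> es Us; rewrite big_cons eqxx IHs //; congr (_ * _).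
rewrite !big_seq; apply: eq_bigr => f fs; case: eqP => // ef.
by rewrite ef fs in es.
Qed.

Local Notation bridge_weight := (k1 * x + k2 * w + m * x' + l * w').
Local Notation loop_weight := (k2 * y + k1 * z + l * y' + m * z').

Lemma cut_active_not_cycle O e : cut_active O e -> cycle_active O e = false.
Proof.
move=> act; apply: contraNF act; apply: reach_sub; exact: subsetUl.
Qed.

(** All three tests see [O] only through the edges other than [e]. *)
Lemma away_active O O' e : away e O = away e O' ->
  [/\ cut_active O e = cut_active O' e, cycle_active O e = cycle_active O' e
    & phi_sign O e = phi_sign O' e].
Proof.
move=> E; have arcsE : cycle_arcs le O e = cycle_arcs le O' e.
  apply/setP=> d; rewrite !in_setI [d \in both_dirs _]inE.
  have [->|d1] := eqVneq d.1 e; first by rewrite mem_above below_irr !andbF.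
  by move/setP: E => /(_ d); rewrite !in_away d1 /= => ->.
have cutE : cut_active O e = cut_active O' e by rewrite /cut_active /cut_arcs arcsE.
have cycE : cycle_active O e = cycle_active O' e by rewrite /cycle_active arcsE.
by rewrite /phi_sign cutE cycE /forward E.
Qed.

(** The Booleans [p] and [n] say whether the positive and the negative arc are present, which
    reduces [weight] to a finite case analysis. *)
Definition local_weight (ca cy sgn p n : bool) : R :=
  let in_phi := if sgn then p else n in
    k1 ^+ ((p (+) n) && in_phi) * k2 ^+ ((p (+) n) && ~~ in_phi)
  * l ^+ (~~ p && ~~ n) * m ^+ (p && n)
  * x ^+ [&& ca, p (+) n & p] * w ^+ [&& ca, p (+) n & n]
  * x' ^+ [&& ca, p & n] * w' ^+ [&& ca, ~~ p & ~~ n]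
  * y ^+ [&& cy, p (+) n & p] * z ^+ [&& cy, p (+) n & n]
  * y' ^+ [&& cy, ~~ p & ~~ n] * z' ^+ [&& cy, p & n].

Lemma weightE O e : weight O e =
  local_weight (cut_active O e) (cycle_active O e) (phi_sign O e)
    ((e, true) \in O) ((e, false) \in O).
Proof.
rewrite /weight /local_weight.
have -> : ((e, phi_sign O e) \in O)
    = if phi_sign O e then (e, true) \in O else (e, false) \in O.
  by case: (phi_sign O e).
rewrite ![e \in oriented_pos O]inE ![e \in oriented_neg O]inE !mem_oriented.
by rewrite ![e \in unoriented O]inE ![e \in bioriented O]inE.
Qed.

(** Edges outside [s] are settled: those in [C] are contracted, the others deleted. *)
Definition four_sum C s : R :=
  \sum_(O : fourientation G | O :\: both_dirs [set f in s] == both_dirs C)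
     run_weight s O.

Lemma four_sum_nil C : four_sum C [::] = 1.
Proof.
rewrite /four_sum (big_pred1 (both_dirs C)) // => O /=.
by congr (_ == _); apply/setP => d; rewrite !inE.
Qed.

Section Step.

Variables (C : {set edge G}) (s : seq (edge G)) (e : edge G).
Hypotheses (es : e \notin s) (eC : e \notin C).

Local Notation fits O := (O :\: both_dirs [set f in s] == both_dirs C).

Lemma fits_notin O b : fits O -> (e, b) \notin O.
Proof.
move=> /eqP/setP/(_ (e, b)); rewrite in_setD ![_ \in both_dirs _]inE inE /=.
by rewrite es (negPf eC) /= => ->.
Qed.

Lemma four_sum_cons : four_sum C (e :: s) =
  \sum_(O : fourientation G | fits O)
    (run_weight (e :: s) O + run_weight (e :: s) ((e, false) |: O)
     + (run_weight (e :: s) ((e, true) |: O)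
        + run_weight (e :: s) ((e, true) |: ((e, false) |: O)))).
Proof.
have absorb b O : ((e, b) |: O) :\: both_dirs [set f in e :: s]
                  = O :\: both_dirs [set f in e :: s].
  apply/setP=> d; rewrite !in_setD in_setU1; have [->|//] := eqVneq d (e, b).
  by rewrite !inE eqxx.
rewrite /four_sum (sum_setU1 (a := (e, false))) => [|O]; last by rewrite absorb.
rewrite (sum_setU1 (a := (e, true))) => [|O]; last first.
  by rewrite absorb in_setU1 xpair_eqE andbF.
apply: eq_big => [O|O _]; last by rewrite setUCA.
apply/andP/idP => [[/andP[/eqP/setP fO nf] nt]|fO]; last first.
  split; last exact: fits_notin.
  rewrite fits_notin // andbT -(eqP fO); apply/eqP/setP=> -[f b].
  rewrite !in_setD ![_ \in both_dirs _]inE !inE /=.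
  by have [->|] := eqVneq f e; rewrite ?es //= (negPf (fits_notin _ fO)).
apply/eqP/setP=> -[f b]; have := fO (f, b).
rewrite !in_setD ![_ \in both_dirs _]inE !inE /= => <-.
have [->|] := eqVneq f e; rewrite ?es //=.
by case: b; apply/negbTE.
Qed.

Lemma run_weight_step O O' : away e O' = O ->
  run_weight (e :: s) O' =
  local_weight (cut_active O e) (cycle_active O e) (phi_sign O e)
    ((e, true) \in O') ((e, false) \in O')
  * run_weight s (if [&& ~~ cut_active O e, ~~ cycle_active O e
       & if phi_sign O e then (e, true) \in O' else (e, false) \in O']
     then O :|: dirs e else O).
Proof.
move=> O'E; have awO : away e O' = away e O.
  by rewrite O'E; apply/setP=> d; rewrite -O'E !in_away; case: eqP.
have [ca cy sgn] := away_active awO.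
rewrite /= weightE ca cy sgn; congr (_ * run_weight _ _).
rewrite /eliminate /contracted ca cy sgn O'E.
have -> : ((e, phi_sign O e) \in O')
    = if phi_sign O e then (e, true) \in O' else (e, false) \in O'.
  by case: (phi_sign O e).
case: ifP => _; last by [].
apply/setP=> d; rewrite !in_setU -O'E in_away ![d \in both_dirs _]inE in_set1.
by case: (d.1 =P e) => _; rewrite ?orbT.
Qed.

(** An active edge is deleted in all four states, so the weights add up. Otherwise the bioriented
    state and one orientation, of weights [m] and [k1], contract; the unoriented state and the other
    orientation, of weights [l] and [k2], delete. *)
Lemma four_sum_step O : fits O ->
  run_weight (e :: s) O + run_weight (e :: s) ((e, false) |: O)
  + (run_weight (e :: s) ((e, true) |: O)
      + run_weight (e :: s) ((e, true) |: ((e, false) |: O)))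
  = if cut_active O e then bridge_weight * run_weight s O
    else if cycle_active O e then loop_weight * run_weight s O
    else (k1 + m) * run_weight s (O :|: dirs e) + (k2 + l) * run_weight s O.
Proof.
move=> fO; have nO b := negPf (fits_notin b fO).
have aw O' : (forall d, d.1 != e -> (d \in O') = (d \in O)) -> away e O' = O.
  move=> O'E; apply/setP=> -[f b]; rewrite in_away /=.
  by have [->|fe] := eqVneq f e; [rewrite nO | rewrite O'E].
have fresh b c : ((e, b) == (e, c)) = (b == c) by rewrite xpair_eqE eqxx.
have other d b : d.1 != e -> (d == (e, b)) = false.
  by move=> de; apply/eqP => dE; rewrite dE eqxx in de.
have aw1 b : away e ((e, b) |: O) = O.
  by apply: aw => d de; rewrite in_setU1 other.
have aw2 : away e ((e, true) |: ((e, false) |: O)) = O.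
  by apply: aw => d de; rewrite !in_setU1 !other.
rewrite (run_weight_step (aw O _)) // !(run_weight_step (aw1 _)).
rewrite (run_weight_step aw2) !in_setU1 !fresh !nO /=.
rewrite /phi_sign /local_weight; have := @cut_active_not_cycle O e.
case: cut_active => [->|_] //=; last case: cycle_active => /=;
  last case: forward => /=; rewrite !(expr0, expr1, mul1r, mulr1); ring.
Qed.

(* Contracting [e] moves it to the set [C] of contracted edges. *)
Lemma sum_fits_setU (F : fourientation G -> R) :
  \sum_(O : fourientation G | fits O) F (O :|: dirs e) =
  \sum_(O : fourientation G
      | O :\: both_dirs [set f in s] == both_dirs (e |: C)) F O.
Proof.
rewrite [RHS](reindex_onto (fun O => O :|: dirs e) (away e)) /=
  => [|O /eqP/setP fO].
  apply: eq_bigl => O; apply/idP/andP => [fO|[/eqP/setP fO /eqP/setP awO]].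
    split; apply/eqP/setP=> -[f b].
      move/eqP/setP/(_ (f, b)): (fO); rewrite !in_setD in_setU.
      rewrite ![_ \in both_dirs _]inE !inE /= andb_orr => ->.
      by have [->|] := eqVneq f e; rewrite ?es ?orbT //= andbF orbF.
    rewrite in_away in_setU [_ \in dirs e]inE in_set1 /=.
    by have [->|] := eqVneq f e; rewrite ?orbF // (negPf (fits_notin b fO)).
  apply/eqP/setP=> -[f b]; have := fO (f, b); have := awO (f, b).
  rewrite in_away !in_setD in_setU ![_ \in both_dirs _]inE !inE /=.
  have [->|fe] := eqVneq f e; last by rewrite orbF.
  by move=> /= <- _; rewrite andbF; apply/esym/negbTE.
apply/setP=> -[f b]; rewrite in_setU in_away [_ \in dirs e]inE in_set1 /=.
have [->|] := eqVneq f e; rewrite ?orbF //=.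
have := fO (e, b); rewrite in_setD ![_ \in both_dirs _]inE !inE /= eqxx /=.
by case/andP.
Qed.

Hypothesis descs : descending le (e :: s).

(** The edges above [e] are exactly those outside [e :: s], all settled according to [C]. *)
Lemma fits_cycle_arcs O : fits O -> cycle_arcs le O e = both_dirs C.
Proof.
move=> fO; case: descs => sE _; apply/setP=> -[f b].
move/eqP/setP/(_ (f, b)): (fO).
rewrite in_setI in_setD !in_both_dirs in_set sE mem_above /=.
have [->|fe|ef] := below_total le_order e f.
- by rewrite below_irr (negPf eC) andbF.
- rewrite fe /= => <-; apply/negbTE/negP => /andP[_]; exact: (below_asym le_order).
have -> : (f \in below le e) = false by apply/negP; apply: (below_asym le_order).
by rewrite ef andbT.
Qed.

Lemma fits_cycle_active O : fits O -> cycle_active O e = joined Oref C e.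
Proof.
move=> fO; rewrite /cycle_active (fits_cycle_arcs fO).
by rewrite -[e in RHS]/((e, false).1) joinedE.
Qed.

Lemma fits_cut_active O : fits O ->
  cut_active O e = ~~ joined Oref (C :|: [set f in s]) e.
Proof.
move=> fO; rewrite /cut_active /cut_arcs (fits_cycle_arcs fO).
rewrite -[e in RHS]/((e, false).1) joinedE; congr (~~ reach _ _ _ _).
case: descs => sE _; apply/setP=> d; rewrite in_setU ![_ \in both_dirs _]inE.
by rewrite in_setU [_ \in [set _ in _]]inE sE.
Qed.

End Step.

Lemma descending_notin s e : descending le (e :: s) -> e \notin s.
Proof. by case=> -> _; rewrite below_irr. Qed.

Lemma descending_uniq s : descending le s -> uniq s.
Proof.
elim: s => // e s IHs des; rewrite /= (descending_notin des) IHs //.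
by case: des.
Qed.

Variables P Q : R.
Hypotheses (PE : P = bridge_weight) (QE : Q = loop_weight).

(** Both sides satisfy the same bridge, loop and deletion-contraction recursion; [C] varies in the
    induction because contraction enlarges it. *)
Lemma four_sumE C s : descending le s -> (forall e, e \in s -> e \notin C) ->
  four_sum C s = subgraph_sum P (k1 + m) Q (k2 + l) C s.
Proof.
elim: s C => [|e s IHs] C des dis; first by rewrite four_sum_nil subgraph_sum_nil.
have es := descending_notin des; have eC := dis e (mem_head _ _).
have Us := descending_uniq des; have ds : descending le s by case: des.
have IH : four_sum C s = subgraph_sum P (k1 + m) Q (k2 + l) C s.
  by apply: IHs => // f fs; apply: dis; rewrite in_cons fs orbT.
have IHe : four_sum (e |: C) s = subgraph_sum P (k1 + m) Q (k2 + l) (e |: C) s.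
  apply: IHs => // f fs; rewrite in_setU1 negb_or dis ?in_cons ?fs ?orbT //.
  by rewrite andbT; apply: contraNneq es => <-.
rewrite (four_sum_cons es eC); under eq_bigr => O fO.
  rewrite (four_sum_step es eC fO) (fits_cut_active eC des fO).
  rewrite (fits_cycle_active eC des fO); over.
have [j|nj] := boolP (joined Oref (C :|: [set f in s]) e); last first.
  by rewrite -mulr_sumr -PE (subgraph_sum_bridge _ _ _ _ Us nj) -IH.
have [jC|njC] := boolP (joined Oref C e).
  by rewrite -mulr_sumr -QE (subgraph_sum_loop _ _ _ _ Us jC) -IH.
rewrite big_split -!mulr_sumr (subgraph_sum_ordinary _ _ _ _ Us j njC) -IH -IHe.
by rewrite (sum_fits_setU es eC (run_weight s)).
Qed.

End FourientationSum.

(** * From the edge-by-edge recursion to the Tutte polynomial identity *)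

Section Assembly.

Import GRing.Theory.
Local Open Scope ring_scope.

Lemma prodr_expr_mem (T : finType) (R : comNzRingType) (c : R) (A : {set T}) :
  \prod_(e : T) c ^+ (e \in A) = c ^+ #|A|.
Proof.
rewrite -prodr_const [RHS]big_mkcond; apply: eq_bigr => e _.
by case: (e \in A).
Qed.

Variables (G : multigraph) (Oref : ref_orientation G).

Lemma kappa_set0 : kappa (set0 : {set edge G}) = #|vertex G|.
Proof.
apply: eq_card => u; rewrite !inE /= andbT /roots.
(* Without edges the walk from [u] to its canonical root is empty. *)
have /connectP[[|v p] /=] := connect_root (adj (set0 : {set edge G})) u.
  by move=> _ ->; rewrite eqxx.
by case/andP=> /existsP[e]; rewrite inE.
Qed.

Lemma rank_set0 : rank (set0 : {set edge G}) = 0%N.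
Proof. by rewrite /rank kappa_set0 subnn. Qed.

Lemma subgraph_sum_tutte (F : fieldType) (P p Q q : F) (s : seq (edge G)) :
    p != 0 -> q != 0 -> uniq s -> (forall e, e \in s) ->
  p ^+ (#|vertex G| - kappa [set: edge G])
    * q ^+ (#|edge G| + kappa [set: edge G] - #|vertex G|)
    * tutte_eval G (P / p) (Q / q)
  = subgraph_sum P p Q q set0 s.
Proof.
move=> p0 q0 Us alls; have sT : [set e in s] = [set: edge G].
  by apply/setP=> e; rewrite !inE alls.
have size_s : size s = #|edge G|.
  by rewrite -(card_uniqP Us); apply: eq_card => e; rewrite alls.
rewrite tutte_evalE mulr_sumr /subgraph_sum sT.
apply: eq_big => [S|S _]; first by rewrite subsetT.
rewrite /subgraph_term sT !set0U rank_set0 size_s.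
have kS := kappaS Oref (subsetT S); have kn := kappa_le S.
have bS := rank_bound Oref set0 S; rewrite set0U rank_set0 in bS.
have bT := rank_bound Oref S (~: S); rewrite setUCr in bT.
have cS := cardsC S; move: kn bS bT; rewrite /rank.
set a := kappa S in kS *; set n := #|vertex G|; set k := kappa _ in kS *.
move=> kn bS bT.
have -> : (n - k - (n - a) = a - k)%N by lia.
(* The prefactor exponents are split so that the denominators' powers of [p] and [q] cancel
   exactly. *)
have -> : (n - k = (a - k) + (n - a))%N by lia.
have -> : (n - a - 0 = n - a)%N by lia.
have -> : (#|S| + 0 - (n - a) = #|S| + a - n)%N by lia.
have -> : (#|edge G| + k - n
           = (#|S| + a - n)
             + (#|edge G| + (n - a) - (#|S| + (a - k + (n - a)))))%N by lia.
have -> : P / p - 1 = (P - p) / p by rewrite mulrBl divff.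
have -> : Q / q - 1 = (Q - q) / q by rewrite mulrBl divff.
rewrite !exprD !expr_div_n; field.
by rewrite !expf_neq0.
Qed.

Variable le : rel (edge G).
Hypothesis le_order : total_order le.
Variables su sb : edge G -> bool.
Implicit Types (O : fourientation G) (e f : edge G) (s : seq (edge G)).

Local Notation stage := (stage Oref le su sb).

Lemma mem_stage s O e b : ((e, b) \in stage s O e) = ((e, b) \in O).
Proof.
elim: s O => //= f s IHs O; case: eqP => // /eqP fe.
by rewrite IHs eliminate_neq // eq_sym.
Qed.

(** The state of [e] is untouched until its own turn, so the weights are determined by its
    membership in sets depending on [O], and the product over edges collects into cardinalities. *)
Lemma run_weight_monomial (R : comNzRingType)
    (k1 k2 l m x w x' w' y z y' z' : R) s O :
    uniq s -> (forall e, e \in s) ->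
  run_weight Oref le su sb k1 k2 l m x w x' w' y z y' z' s O =
    k1 ^+ #|oriented O :&: phi_map Oref le su sb s O|
  * k2 ^+ #|oriented O :\: phi_map Oref le su sb s O|
  * l ^+ #|unoriented O| * m ^+ #|bioriented O|
  * x ^+ #|cut_activity Oref le su sb s O :&: oriented_pos O|
  * w ^+ #|cut_activity Oref le su sb s O :&: oriented_neg O|
  * x' ^+ #|cut_activity Oref le su sb s O :&: bioriented O|
  * w' ^+ #|cut_activity Oref le su sb s O :&: unoriented O|
  * y ^+ #|cycle_activity Oref le su sb s O :&: oriented_pos O|
  * z ^+ #|cycle_activity Oref le su sb s O :&: oriented_neg O|
  * y' ^+ #|cycle_activity Oref le su sb s O :&: unoriented O|
  * z' ^+ #|cycle_activity Oref le su sb s O :&: bioriented O|.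
Proof.
move=> Us alls; rewrite run_weight_prod // big_uniq //=.
rewrite -!prodr_expr_mem -!big_split /=; apply: eq_big => [e|e _].
  by rewrite alls.
have orE : (e \in oriented (stage s O e)) = (e \in oriented O).
  by rewrite !mem_oriented !mem_stage.
rewrite /weight mem_stage orE.
have -> : (e \in unoriented (stage s O e)) = (e \in unoriented O).
  by rewrite !inE !mem_stage.
have -> : (e \in bioriented (stage s O e)) = (e \in bioriented O).
  by rewrite !inE !mem_stage.
have -> : (e \in oriented_pos (stage s O e)) = (e \in oriented_pos O).
  by rewrite ![e \in oriented_pos _]inE orE mem_stage.
have -> : (e \in oriented_neg (stage s O e)) = (e \in oriented_neg O).
  by rewrite ![e \in oriented_neg _]inE orE mem_stage.
rewrite !in_setI in_setD [e \in phi_map _ _ _ _ _ _]inE.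
rewrite [e \in cut_activity _ _ _ _ _ _]inE [e \in cycle_activity _ _ _ _ _ _]inE.
by rewrite [X in k2 ^+ nat_of_bool X]andbC.
Qed.

Lemma fourientation_sum_tutte (F : fieldType)
    (k1 k2 l m x w x' w' y z y' z' : F) s :
    k1 + m != 0 -> k2 + l != 0 -> descending le s -> (forall e, e \in s) ->
  \sum_(O : fourientation G)
     run_weight Oref le su sb k1 k2 l m x w x' w' y z y' z' s O =
  (k1 + m) ^+ (#|vertex G| - kappa [set: edge G])
    * (k2 + l) ^+ (#|edge G| + kappa [set: edge G] - #|vertex G|)
    * tutte_eval G ((k1 * x + k2 * w + m * x' + l * w') / (k1 + m))
                   ((k2 * y + k1 * z + l * y' + m * z') / (k2 + l)).
Proof.
move=> p0 q0 des alls.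
rewrite (subgraph_sum_tutte _ _ p0 q0 (descending_uniq des) alls).
rewrite -(four_sumE Oref le_order su sb (x := x) (w := w) (x' := x') (w' := w')
  (y := y) (z := z) (y' := y') (z' := z') erefl erefl des) => [|e _]; last first.
  by rewrite inE.
apply: eq_bigl => O; apply/esym/eqP/setP => d.
by rewrite in_setD !in_both_dirs !inE alls.
Qed.

End Assembly.

From mathcomp Require Import mpoly.
Require Import Defs.

Local Open Scope ring_scope.

Import GRing.Theory.

(** The coefficient of the [i]-th indeterminate is 1, or 2 if [i = j], hence nonzero over the
    integers. *)
Lemma indetD_neq0 (i j : 'I_12) : indet i + indet j != 0.
Proof.
rewrite /indet -tofracD tofrac_eq0; apply/eqP => /(congr1 (mcoeff U_(i)%MM)).
by rewrite mcoeffD mcoeff0 !mcoeffX eqxx; case: (_ == _).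
Qed.

Theorem theorem1p1 (G : multigraph) (Oref : ref_orientation G)
    (le : rel (edge G)) (le_order : total_order le)
    (su sb : edge G -> bool) :
  exists (I L phi : fourientation G -> {set edge G}),
  [/\ cut_activities Oref le su I, cycle_activities Oref le sb L &
    let k1 := indet (inord 0) in let k2 := indet (inord 1) in
    let l := indet (inord 2) in let m := indet (inord 3) in
    let x := indet (inord 4) in let w := indet (inord 5) in
    let x' := indet (inord 6) in let w' := indet (inord 7) in
    let y := indet (inord 8) in let z := indet (inord 9) in
    let y' := indet (inord 10) in let z' := indet (inord 11) in
    let n := #|vertex G| in
    let kap := kappa [set: edge G] in
    let g := (#|edge G| + kap - n)%N in
    (k1 + m) ^+ (n - kap) * (k2 + l) ^+ g
      * tutte_eval G ((k1 * x + k2 * w + m * x' + l * w') / (k1 + m))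
                     ((k2 * y + k1 * z + l * y' + m * z') / (k2 + l))
    = \sum_(O : fourientation G)
        k1 ^+ #|oriented O :&: phi O| * k2 ^+ #|oriented O :\: phi O|
      * l ^+ #|unoriented O| * m ^+ #|bioriented O|
      * x ^+ #|I O :&: oriented_pos O| * w ^+ #|I O :&: oriented_neg O|
      * x' ^+ #|I O :&: bioriented O| * w' ^+ #|I O :&: unoriented O|
      * y ^+ #|L O :&: oriented_pos O| * z ^+ #|L O :&: oriented_neg O|
      * y' ^+ #|L O :&: unoriented O| * z' ^+ #|L O :&: bioriented O|].
Proof.
have [s des alls] := descending_enum le_order.
exists (cut_activity Oref le su sb s), (cycle_activity Oref le su sb s).
exists (phi_map Oref le su sb s).
split; [exact: cut_activitiesP | exact: cycle_activitiesP |].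
move=> k1 k2 l m x w x' w' y z y' z' n kap g.
rewrite -(fourientation_sum_tutte Oref le_order su sb x w x' w' y z y' z'
  (indetD_neq0 _ _) (indetD_neq0 _ _) des alls).
by apply: eq_bigr => O _; rewrite run_weight_monomial // (descending_uniq des).
Qed.
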